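(* There do not exist $K\in\mathbb{R}$ and $\beta>0$ such that the measured geodesic space $(\mathcal{P}_0,d^W,\mathbb{P}^\beta_0)$ has generalized $\mathrm{Ric}\geq K$. Here $\mathcal{P}_0=\mathcal{P}([0,1])$ is the set of Borel probability measures on $[0,1]$, $d^W$ is the 2-Wasserstein distance on $\mathcal{P}_0$, and $\mathbb{P}^\beta_0$ is the entropic measure on $\mathcal{P}_0$ with parameter $\beta$.
   Context: **Wasserstein distance.** For a compact metric space $(X,d)$, $\mathcal{P}(X)$ denotes the set of Borel probability measures on $X$. For $\mu,\nu\in\mathcal{P}(X)$, let $\Pi(\mu,\nu)$ be the set of $\pi\in\mathcal{P}(X\times X)$ with first marginal $\mu$ and second marginal $\nu$. The 2-Wasserstein distance is given by $$d^W(\mu,\nu)^2 := \inf_{\pi\in\Pi(\mu,\nu)}\int_{X\times X} d(x,y)^2\, d\pi(x,y).$$ On $\mathcal{P}_0=\mathcal{P}([0,1])$ this is taken with $X=[0,1]$ and $d(x,y)=|x-y|$. In the definition of generalized Ricci bounds for the space $(\mathcal{P}_0,d^W,\mathbb{P}^\beta_0)$, the definitions below are applied with $X=\mathcal{P}_0$ and $d$ equal to this distance. **Geodesics.** A geodesic from $x_0$ to $x_1$ in a metric space is a continuous curve $\gamma:[0,1]\to X$ with $\gamma(0)=x_0$, $\gamma(1)=x_1$, whose length $\sup_{0=t_0<\dots<t_{N+1}=1}\sum_{i=0}^N d(\gamma(t_i),\gamma(t_{i+1}))$ equals $d(x_0,x_1)$, parametrized with constant speed, i.e. $d(\gamma(s),\gamma(t))=|s-t|\,d(x_0,x_1)$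 for all $s,t\in[0,1]$. A geodesic space is a metric space in which any two points are joined by a geodesic. A measured geodesic space $(X,d,m)$ is a geodesic space $(X,d)$ with a fixed $m\in\mathcal{P}(X)$. **Entropy.** For $m\in\mathcal{P}(X)$, $\mathrm{Ent}(\cdot|m):\mathcal{P}(X)\to\mathbb{R}\cup\{+\infty\}$ is defined by $\mathrm{Ent}(\mu|m)=\int_X\rho\log\rho\, dm$ if $\mu=\rho m\ll m$ (with $0\log 0=0$), and $\mathrm{Ent}(\mu|m)=+\infty$ otherwise. **Generalized Ricci bound.** A measured geodesic space $(X,d,m)$ has generalized $\mathrm{Ric}\geq K$ if $\mathrm{Ent}(\cdot|m)$ is weakly a.c. $K$-displacement convex, that is: for any $\mu_0,\mu_1\in\mathcal{P}(X)$ with $\mu_0,\mu_1\ll m$ there exists a geodesic $(\mu_t)_{t\in[0,1]}$ in $(\mathcal{P}(X),d^W)$ from $\mu_0$ to $\mu_1$ such that for all $t\in[0,1]$ $$\mathrm{Ent}(\mu_t|m)\leq t\,\mathrm{Ent}(\mu_1|m)+(1-t)\,\mathrm{Ent}(\mu_0|m)-\tfrac{K}{2}t(1-t)\,d^W(\mu_0,\mu_1)^2.$$ **The space $\mathcal{G}_0$.** $\mathcal{G}_0\subset L^2([0,1])$ is the set of (classes of) right continuous nondecreasing functions $g:[0,1]\to[0,1]$, with the metric $d^{L^2}$ induced by the $L^2$ norm; as usual in $L^2$, functions equal almost everywhere are identified, and for $s\in[0,1)$, $g(s)$ denotes the value of the right continuous representative. The map $\Psi:(\mathcal{G}_0,d^{L^2})\to(\mathcal{P}_0,d^W)$,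 $\Psi(g)=g_*\mathrm{Leb}$ (push-forward of Lebesgue measure on $[0,1]$), is a bijective isometry (a known fact). **The entropic measure.** For $\beta>0$, $\mathbb{Q}^\beta_0\in\mathcal{P}(\mathcal{G}_0)$ is the unique probability measure (existence and uniqueness due to von Renesse and Sturm) such that for each partition $0=t_0<t_1<\dots<t_N<t_{N+1}=1$ and each bounded measurable $u:[0,1]^N\to\mathbb{R}$, $$\int_{\mathcal{G}_0}u(g(t_1),\dots,g(t_N))\,d\mathbb{Q}^\beta_0(g)=\frac{\Gamma(\beta)}{\prod_{i=0}^N\Gamma(\beta(t_{i+1}-t_i))}\int_{\Sigma_N}u(x_1,\dots,x_N)\prod_{i=0}^N(x_{i+1}-x_i)^{\beta(t_{i+1}-t_i)-1}\,dx_1\cdots dx_N,$$ where $\Sigma_N=\{(x_1,\dots,x_N)\in[0,1]^N:0=x_0<x_1<\dots<x_N<x_{N+1}=1\}$ and $\Gamma$ is the Gamma function. The entropic measure on $\mathcal{P}_0$ is the push-forward $\mathbb{P}^\beta_0:=\Psi_*\mathbb{Q}^\beta_0\in\mathcal{P}(\mathcal{P}_0)$. *)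

(* Defs.v *)
From HB Require Import structures.
From mathcomp Require Import all_boot all_order all_algebra generic_quotient.
From mathcomp Require Import all_classical all_reals all_analysis.
From mathcomp Require Import measurable_realfun.
From mathcomp Require Import ring lra.

Set Implicit Arguments.
Unset Strict Implicit.
Unset Printing Implicit Defensive.

Import Order.TTheory GRing.Theory Num.Theory.
Import numFieldNormedType.Exports.

Local Open Scope classical_set_scope.
Local Open Scope ring_scope.

(* A metric is a bare function [d : X -> X -> R], so that [wasserstein d] below
   can in turn play the role of [d]. [metric_open d] is the topology of [d], and
   [borel d] is [X] with the Borel sigma-algebra of that topology. *)
Definition metric_open (R : realType) (X : Type) (d : X -> X -> R) :
    set (set X) :=
  [set U | forall x, U x -> exists2 e, 0 < e & [set y | d x y < e] `<=` U].

Notation borel d := (g_sigma_algebraType (metric_open d)).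

(* A [probability] is a function on all subsets, so measures agreeing on Borel
   sets may be distinct terms. They are at [wasserstein] distance 0, hence no
   Borel set of the Wasserstein space tells them apart. *)
Notation Prob R d := (probability (borel d) R).

(* The subdivision a, s_0, ..., s_(N-1), b; [nth] numbers it from 0 to N.+1. *)
Definition knots (T : Type) (a b : T) (s : seq T) : seq T := a :: rcons s b.

Section metric_measure_notions.
Context {R : realType}.
Implicit Type X : pointedType.

(* A metric for the product topology, so that [Prob R (dist_prod d)] is the set
   of Borel probability measures on X * X. *)
Definition dist_prod (X : Type) (d : X -> X -> R) (z w : X * X) : R :=
  Num.max (d z.1 w.1) (d z.2 w.2).

Definition coupling X (d : X -> X -> R) (mu nu : Prob R d) :
    set (Prob R (dist_prod d)) :=
  [set pi : Prob R (dist_prod d) | forall A : set (borel d), measurable A ->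
      pi (fst @^-1` A) = mu A /\ pi (snd @^-1` A) = nu A].

(* [fine] loses nothing: for [d] bounded and separable the set of couplings is
   not empty and the infimum is finite. *)
Definition wasserstein X (d : X -> X -> R) (mu nu : Prob R d) : R :=
  Num.sqrt (fine (ereal_inf
    [set (\int[pi]_z (d z.1 z.2 ^+ 2)%:E)%E | pi in coupling mu nu])).

Arguments wasserstein {X} d mu nu.

Definition entropy X (d : X -> X -> R) (m mu : Prob R d) : \bar R :=
  if `[< mu `<< m >] then
    (\int[m]_x
      (let rho := fine (Radon_Nikodym (charge_of_finite_measure mu) m x) in
       rho * ln rho)%:E)%E
  else +oo%E.

Definition continuous_curve (X : Type) (d : X -> X -> R) (c : {i01 R} -> X) :=
  forall s (e : R), 0 < e -> exists2 r : R, 0 < r &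
    forall t, `|s%:num - t%:num| < r -> d (c s) (c t) < e.

Definition curve_length (X : Type) (d : X -> X -> R) (c : {i01 R} -> X) :
    \bar R :=
  ereal_sup [set l | exists N (t : N.-tuple {i01 R}),
    let k := nth 0%:i01 (knots 0%:i01 1%:i01 t) in
    sorted <%O (knots 0%:i01 1%:i01 t) /\
    l = (\sum_(i < N.+1) d (c (k i)) (c (k i.+1)))%:E].

Definition is_geodesic (X : Type) (d : X -> X -> R) (x0 x1 : X)
    (c : {i01 R} -> X) :=
  [/\ continuous_curve d c, c 0%:i01 = x0, c 1%:i01 = x1,
      curve_length d c = (d x0 x1)%:E
    & forall s t, d (c s) (c t) = `|s%:num - t%:num| * d x0 x1].

(* [entropy] never takes the value -oo and 0 * +oo = 0 in [\bar R], so the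
   right-hand side is the usual one also for infinite entropies. *)
Definition generalized_Ric_ge X (d : X -> X -> R) (m : Prob R d) (K : R) :=
  forall mu0 mu1 : Prob R d, mu0 `<< m -> mu1 `<< m ->
  exists2 c : {i01 R} -> Prob R d, is_geodesic (wasserstein d) mu0 mu1 c &
    forall t : {i01 R},
      (entropy m (c t) <= t%:num%:E * entropy m mu1
         + (1 - t%:num)%:E * entropy m mu0
         - (K / 2 * t%:num * (1 - t%:num) * wasserstein d mu0 mu1 ^+ 2)%:E)%E.

End metric_measure_notions.

Arguments wasserstein {R X} d mu nu.
Arguments generalized_Ric_ge {R X} d m K.

HB.instance Definition _ (R : realType) := isPointed.Build {i01 R} 0%:i01.

Section unit_interval.
Context {R : realType}.
Local Notation I := {i01 R}.

Definition dist01 (x y : I) : R := `|x%:num - y%:num|.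

Lemma measurable_num01 :
  measurable_fun [set: borel dist01] (fun x : I => x%:num : measurableTypeR R).
Proof.
apply: (measurability _ (RGenOInfty.measurableE R)) => //.
move=> /= _ [_ [x ->] <-]; rewrite setTI; apply: sub_sigma_algebra => y /=.
rewrite in_itv/= andbT => xy.
exists (y%:num - x); first by rewrite subr_gt0.
move=> z /=; rewrite /dist01 in_itv/= andbT => h.
by have := ler_norm (y%:num - z%:num); move: h xy; lra.
Qed.

Fact clamp_ge0 (x : R) : 0 <= Num.max 0 (Num.min x 1).
Proof. by rewrite le_max lexx. Qed.

Fact clamp_le1 (x : R) : Num.max 0 (Num.min x 1) <= 1.
Proof. by rewrite ge_max ler01 ge_min lexx orbT. Qed.

Definition clamp01 (x : R) : I := Itv01 (clamp_ge0 x) (clamp_le1 x).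

Lemma clamp01K (x : I) : clamp01 x%:num = x.
Proof.
by apply/val_inj => /=; rewrite min_l// max_r.
Qed.

Lemma clamp01_val (x : R) : 0 <= x <= 1 -> (clamp01 x)%:num = x.
Proof. by case/andP => ? ? /=; rewrite min_l// max_r. Qed.

Lemma le_clamp01 : {homo clamp01 : x y / x <= y}.
Proof.
move=> x y xy; change ((clamp01 x)%:num <= (clamp01 y)%:num) => /=.
rewrite ge_max le_max lexx/= le_max; apply/orP; right.
by rewrite le_min !ge_min xy lexx !orbT.
Qed.

Lemma clamp01_lip (x y : R) : `|(clamp01 x)%:num - (clamp01 y)%:num| <= `|x - y|.
Proof.
wlog xy : x y / x <= y.
  move=> h; have [/h//|/ltW/h] := leP x y.
  by rewrite distrC (distrC y).
rewrite distrC (distrC x) ger0_norm ?subr_ge0; last exact: le_clamp01.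
rewrite ger0_norm ?subr_ge0//=.
rewrite /Num.max /Num.min; repeat case: ifPn; rewrite -?leNgt; lra.
Qed.

Lemma measurable_clamp01 :
  measurable_fun [set: measurableTypeR R] (clamp01 : _ -> borel dist01).
Proof.
apply: (@measurability _ _ _ (borel dist01) _ _ (metric_open dist01)) =>
  // _ [U oU <-]; rewrite setTI.
apply: open_measurable; rewrite openE => x /= /oU [e e0 he].
apply/nbhs_ballP; exists e => // y; rewrite /ball/= => xy.
by apply: he => /=; apply: le_lt_trans xy; exact: clamp01_lip.
Qed.

Lemma image_num01 (A : set I) :
  (fun x : I => x%:num) @` A = `[0, 1]%classic `&` clamp01 @^-1` A.
Proof.
apply/seteqP; split => [_ [x Ax <-]|x /= [/[!in_itv]/= x01 Ax]].
  by split; [rewrite /= in_itv/=; apply/andP|rewrite /= clamp01K].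
by exists (clamp01 x) => //; rewrite clamp01_val.
Qed.

Lemma measurable_image_num01 (A : set (borel dist01)) : measurable A ->
  measurable ((fun x : I => x%:num) @` A : set (measurableTypeR R)).
Proof.
move=> mA; rewrite image_num01; apply: measurableI => //.
by rewrite -[X in measurable X]setTI; exact: measurable_clamp01.
Qed.

Definition leb01 (A : set (borel dist01)) : \bar R :=
  lebesgue_measure ((fun x : I => x%:num) @` A).

Let leb01_0 : leb01 set0 = 0%E.
Proof. by rewrite /leb01 image_set0 measure0. Qed.

Let leb01_ge0 A : (0 <= leb01 A)%E.
Proof. exact: measure_ge0. Qed.

Let leb01_sigma_additive : semi_sigma_additive leb01.
Proof.
move=> F mF tF mUF; rewrite /leb01 image_bigcup.
apply: measure_semi_sigma_additive.
- by move=> n; exact: measurable_image_num01.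
- move=> i j _ _ [_ [[x Fix <-] [y Fjy /val_inj yx]]].
  by apply: tF => //; exists x; split => //; rewrite -yx.
- by rewrite -image_bigcup; exact: measurable_image_num01.
Qed.

HB.instance Definition _ := isMeasure.Build _ _ _ leb01
  leb01_0 leb01_ge0 leb01_sigma_additive.

Let leb01_setT : leb01 [set: _] = 1%E.
Proof.
rewrite /leb01 image_num01 preimage_setT setIT.
by rewrite lebesgue_measure_itv/= lte_fin ltr01 oppr0 adde0.
Qed.

HB.instance Definition _ :=
  Measure_isProbability.Build _ _ _ leb01 leb01_setT.

End unit_interval.

Record rc_mono (R : realType) := RcMono {
  rc_fun :> {i01 R} -> {i01 R} ;
  rc_homo : {homo rc_fun : x y / x <= y} ;
  rc_right_cont : forall s (e : R), 0 < e -> exists2 r : R, 0 < r &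
    forall t, s <= t -> t%:num < s%:num + r ->
      `|(rc_fun t)%:num - (rc_fun s)%:num| < e }.

HB.instance Definition _ R := gen_eqMixin (rc_mono R).
HB.instance Definition _ R := gen_choiceMixin (rc_mono R).

Section G0.
Context {R : realType}.
Local Notation I := {i01 R}.

Definition rc_ae_eq (g h : rc_mono R) : bool :=
  `[< {ae (@leb01 R), forall s, g s = h s} >].

Let ae_filter01 : Filter (almost_everywhere (@leb01 R)).
Proof. exact: ae_filter_ringOfSetsType. Qed.

Let rc_ae_eq_refl : reflexive rc_ae_eq.
Proof. by move=> g; apply/asboolP; apply: aeW. Qed.

Let rc_ae_eq_sym : symmetric rc_ae_eq.
Proof.
move=> g h; apply/idP/idP => /asboolP gh; apply/asboolP;
  by apply: (@filterS _ _ ae_filter01 _ _ _ gh) => s ->.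
Qed.

Let rc_ae_eq_trans : transitive rc_ae_eq.
Proof.
move=> g h k /asboolP hg /asboolP gk; apply/asboolP.
by apply: (@filterS2 _ _ ae_filter01 _ _ _ _ hg gk) => s -> ->.
Qed.

Canonical rc_ae_eq_equiv :=
  EquivRel rc_ae_eq rc_ae_eq_refl rc_ae_eq_sym rc_ae_eq_trans.

Definition G0 : Type := {eq_quot rc_ae_eq}%qT.
HB.instance Definition _ := Choice.on G0.
HB.instance Definition _ := EqQuotient.on G0.

Fact rc_cst0_right_cont : forall (s : I) (e : R), 0 < e -> exists2 r : R, 0 < r &
    forall t : I, s <= t -> t%:num < s%:num + r ->
      `|(0%:i01 : I)%:num - (0%:i01 : I)%:num| < e.
Proof. by move=> s e e0; exists 1 => // t _ _; rewrite subrr normr0. Qed.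

Definition rc_cst0 : rc_mono R :=
  @RcMono R (fun=> 0%:i01) (fun _ _ _ => lexx _) rc_cst0_right_cont.

HB.instance Definition _ := isPointed.Build G0 (\pi_G0 rc_cst0)%qT.

(* All representatives are right continuous, so on [0, 1[ their values do not
   depend on the one chosen by [repr]. *)
Definition right_cont_repr (g : G0) : I -> I := rc_fun (repr g).
Coercion right_cont_repr : G0 >-> Funclass.

Definition dL2 (g h : G0) : R :=
  fine (Lnorm (@leb01 R) 2%:E (fun s => ((g s)%:num - (h s)%:num)%:E)).

Lemma measurable_monotone01 (f : I -> I) : {homo f : x y / x <= y} ->
  measurable_fun [set: borel (@dist01 R)] (f : _ -> borel (@dist01 R)).
Proof.
move=> ndf.
have -> : f = clamp01 \o ((fun x : I => x%:num) \o f \o clamp01)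
              \o (fun x : I => x%:num).
  by apply/funext => x /=; rewrite [in RHS]clamp01K clamp01K.
apply: (@measurableT_comp _ _ _ _ (measurableTypeR R)); last first.
  exact: measurable_num01.
apply: (@measurableT_comp _ _ _ _ (measurableTypeR R)).
  exact: measurable_clamp01.
apply: nondecreasing_measurable => // x y xy /=.
exact/ndf/le_clamp01.
Qed.

Definition transport_map (g : G0) : borel (@dist01 R) -> borel (@dist01 R) := g.

HB.instance Definition _ (g : G0) :=
  isMeasurableFun.Build _ _ _ _ (transport_map g)
    (measurable_monotone01 (@rc_homo R (repr g))).

Definition Psi (g : G0) : Prob R (@dist01 R) :=
  distribution (@leb01 R) (transport_map g).

End G0.
Arguments G0 R : clear implicits.

Section Psi_measurable.
Context {R : realType}.
Local Notation I := {i01 R}.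
Local Notation d01 := (@dist01 R).

Lemma dist01_continuous (x y x' y' : I) :
  `|d01 x y - d01 x' y'| <= d01 x x' + d01 y y'.
Proof.
rewrite /dist01.
set a := x%:num; set b := y%:num; set a' := x'%:num; set b' := y'%:num.
apply: (le_trans (ler_dist_dist _ _)).
rewrite (_ : a - b - (a' - b') = (a - a') - (b - b')); last by ring.
exact: ler_normB.
Qed.

Lemma measurable_dist01_prod :
  measurable_fun [set: borel (dist_prod d01)]
    (fun z : I * I => d01 z.1 z.2 : measurableTypeR R).
Proof.
apply: (measurability _ (RGenOInfty.measurableE R)) => //.
move=> /= _ [_ [c ->] <-]; rewrite setTI; apply: sub_sigma_algebra => z /=.
rewrite in_itv/= andbT => cz.
exists ((d01 z.1 z.2 - c) / 2); first by rewrite divr_gt0// subr_gt0.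
move=> w /=; rewrite in_itv/= andbT /dist_prod gt_max => /andP[h1 h2].
have := dist01_continuous z.1 z.2 w.1 w.2.
by rewrite ler_norml => /andP[_]; move: h1 h2; lra.
Qed.

Definition pair_map (g h : G0 R) :
    borel d01 -> borel (dist_prod d01) := fun s => (g s, h s).

Lemma measurable_pair_map g h : measurable_fun setT (pair_map g h).
Proof.
have mnum (f : G0 R) :
    measurable_fun [set: borel d01] (fun s => (f s)%:num : measurableTypeR R).
  apply: (@measurableT_comp _ _ _ _ (borel d01) _
    (fun x : I => x%:num : measurableTypeR R)); first exact: measurable_num01.
  exact: measurable_monotone01 (@rc_homo R (repr f)).
apply: (@measurability _ _ _ (borel (dist_prod d01)) _ _
  (metric_open (dist_prod d01))) => // _ [U oU <-]; rewrite setTI.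
pose B (p q r : rat) : set (borel d01) :=
  [set s | `|(g s)%:num - ratr p| < ratr r /\ `|(h s)%:num - ratr q| < ratr r].
pose good (p q r : rat) := forall x y : I,
  `|x%:num - ratr p| < ratr r -> `|y%:num - ratr q| < ratr r -> U (x, y).
have -> : pair_map g h @^-1` U =
    \bigcup_p \bigcup_q \bigcup_r (if `[< good p q r >] then B p q r else set0).
  apply/seteqP; split => [s /= /oU [e e0 he]|s [p _ [q _ [r _]]]]; last first.
    by case: asboolP => // gd [? ?]; exact: gd.
  have e20 : 0 < e / 4 by rewrite divr_gt0.
  have [r /andP[r0 re]] : {r : rat | ratr r \in `]e / 4, e / 2[}.
    by apply/cid; have [|r hr] := @rat_in_itvoo R (e / 4) (e / 2); [lra|exists r].
  have [p hp] : {p : rat | ratr p \in `](g s)%:num, ((g s)%:num + e / 4)[}.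
    by apply/cid; have [|p hp] := @rat_in_itvoo R (g s)%:num ((g s)%:num + e / 4);
      [lra|exists p].
  have [q hq] : {p : rat | ratr p \in `](h s)%:num, ((h s)%:num + e / 4)[}.
    by apply/cid; have [|p' hp'] := @rat_in_itvoo R (h s)%:num ((h s)%:num + e / 4);
      [lra|exists p'].
  move: hp hq r0 re; rewrite !in_itv/= => /andP[p1 p2] /andP[q1 q2] r1 r2.
  rewrite !bnd_simp in r1 r2.
  exists p => //; exists q => //; exists r => //; rewrite asboolT.
    by split; rewrite ltr_norml; lra.
  move=> x y xp yq; apply: he => /=; rewrite /dist_prod /dist01/= gt_max.
  by move: xp yq; rewrite !ltr_norml => /andP[? ?] /andP[? ?]; lra.
apply: bigcupT_measurable_rat => p; apply: bigcupT_measurable_rat => q.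
apply: bigcupT_measurable_rat => r; case: asboolP => // _.
rewrite (_ : B p q r = ((fun s => (g s)%:num) @^-1` (ball (ratr p : R) (ratr r))) `&`
     ((fun s => (h s)%:num) @^-1` (ball (ratr q : R) (ratr r)))); last first.
  by apply/seteqP; split => s /=; rewrite /B /ball/= => -[? ?]; split;
    rewrite distrC.
by apply: measurableI; rewrite -[X in measurable X]setTI; apply: mnum => //;
  apply: open_measurable; exact: ball_open.
Qed.

HB.instance Definition _ g h :=
  isMeasurableFun.Build _ _ _ _ (pair_map g h) (measurable_pair_map g h).

Lemma wasserstein_Psi_le (g h : G0 R) : wasserstein d01 (Psi g) (Psi h) <= dL2 g h.
Proof.
set J := (\int[@leb01 R]_s (d01 (g s) (h s) ^+ 2)%:E)%E.
have d01_le1 (x y : I) : d01 x y <= 1.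
  have x0 : 0 <= x%:num by []. have x1 : x%:num <= 1 by [].
  have y0 : 0 <= y%:num by []. have y1 : y%:num <= 1 by [].
  by rewrite /dist01 ler_norml; lra.
pose pi : Prob R (dist_prod d01) := distribution (@leb01 R) (pair_map g h).
have mz : measurable_fun [set: borel (dist_prod d01)]
    (fun z : I * I => (d01 z.1 z.2 ^+ 2)%:E).
  by apply/measurable_EFinP; apply: measurable_funX; exact: measurable_dist01_prod.
have piE : (\int[pi]_z (d01 z.1 z.2 ^+ 2)%:E)%E = J.
  rewrite ge0_integral_distribution//.
  by move=> z; rewrite lee_fin sqr_ge0.
have J0 : (0 <= J)%E by apply: integral_ge0 => s _; rewrite lee_fin sqr_ge0.
have J1 : (J <= 1)%E.
  have : (J <= \int[@leb01 R]_s cst 1%E s)%E.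
    apply: ge0_le_integral => //.
    - by move=> s _; rewrite lee_fin sqr_ge0.
    - exact: (measurableT_comp mz (measurable_pair_map g h)).
    - move=> s _; rewrite lee_fin; rewrite -(expr1n _ 2).
      by rewrite ler_pXn2r ?nnegrE//; exact: normr_ge0.
  by move=> /le_trans; apply; rewrite integral_cst//= mul1e probability_le1.
have Jfin : J \is a fin_num by rewrite ge0_fin_numE// (le_lt_trans J1)// ltry.
have -> : dL2 g h = Num.sqrt (fine J).
  rewrite /dL2 unlock/= (_ : (\int[_]_x _)%E = J); last first.
    by apply: eq_integral => s _ /=; rewrite powR_mulrn.
  by rewrite -(fineK Jfin) poweR_EFin/= powR12_sqrt ?fine_ge0.
have infJ : (ereal_inf [set (\int[pi]_z (d01 z.1 z.2 ^+ 2)%:E)%E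
    | pi in coupling (Psi g) (Psi h)] <= J)%E.
  by rewrite -piE; apply: ereal_inf_lbound; exists pi.
rewrite ler_wsqrtr// fine_le// ge0_fin_numE.
  by rewrite (le_lt_trans infJ)// (le_lt_trans J1)// ltry.
apply: le_ereal_inf_tmp => _ [nu _ <-].
by apply: integral_ge0 => z _; rewrite lee_fin sqr_ge0.
Qed.

Lemma measurable_Psi : measurable_fun [set: borel (@dL2 R)]
  (Psi : _ -> borel (wasserstein d01)).
Proof.
apply: (@measurability _ _ _ (borel (wasserstein d01)) _ _
  (metric_open (wasserstein d01))) => // _ [U oU <-]; rewrite setTI.
apply: sub_sigma_algebra => g /= /oU [e e0 he]; exists e => // h gh.
by apply: he => /=; apply: le_lt_trans gh; exact: wasserstein_Psi_le.
Qed.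

Definition Psi_map : borel (@dL2 R) -> borel (wasserstein d01) := Psi.

HB.instance Definition _ :=
  isMeasurableFun.Build _ _ _ _ Psi_map measurable_Psi.

Definition Psi_pushforward (Q : Prob R (@dL2 R)) : Prob R (wasserstein d01) :=
  distribution Q Psi_map.

End Psi_measurable.

Section entropic_measure.
Context {R : realType}.
Local Notation I := {i01 R}.
Local Open Scope ereal_scope.

(* Lebesgue measure on R^N, by recursion on N: the image of the product of the
   Lebesgue measures on R and R^N under the bijection R * R^N -> R^(N+1). *)
Section lebesgue_tuple_succ.
Context N (m : {sigma_finite_measure set (N.-tuple (measurableTypeR R)) -> \bar R}).

Definition cons_map (z : measurableTypeR R * N.-tuple (measurableTypeR R)) :
    N.+1.-tuple (measurableTypeR R) := [tuple of z.1 :: z.2].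

Let measurable_cons_map : measurable_fun setT cons_map.
Proof. by apply: measurable_cons. Qed.

HB.instance Definition _ := isMeasurableFun.Build _ _ _ _ cons_map measurable_cons_map.

Definition lebesgue_cons : set (N.+1.-tuple (measurableTypeR R)) -> \bar R :=
  pushforward (@lebesgue_measure R \x m) cons_map.

Let lebesgue_cons0 : lebesgue_cons set0 = 0.
Proof. by rewrite /lebesgue_cons /pushforward preimage_set0 measure0. Qed.

Let lebesgue_cons_ge0 A : 0 <= lebesgue_cons A.
Proof. exact: measure_ge0. Qed.

Let lebesgue_cons_sigma_additive : semi_sigma_additive lebesgue_cons.
Proof. exact: measure_semi_sigma_additive. Qed.

HB.instance Definition _ := isMeasure.Build _ _ _ lebesgue_cons
  lebesgue_cons0 lebesgue_cons_ge0 lebesgue_cons_sigma_additive.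

Let lebesgue_cons_sigma_finite : sigma_finite setT lebesgue_cons.
Proof.
have [F FT Ffin] : sigma_finite setT (@lebesgue_measure R \x m).
  have /sigma_finiteP[F [TF ndF Foo]] := sigma_finiteT (@lebesgue_measure R).
  have /sigma_finiteP[G [TG ndG Goo]] := sigma_finiteT m.
  exists (fun n => F n `*` G n).
    rewrite -setXTT TF TG predeqE => -[x y]; split.
      move=> [/= [n _ Fnx] [k _ Gky]]; exists (maxn n k) => //; split.
      - by move: x Fnx; exact/subsetPset/ndF/leq_maxl.
      - by move: y Gky; exact/subsetPset/ndG/leq_maxr.
    by move=> [n _ []/= ? ?]; split; exists n.
  move=> k; have [? ?] := Foo k; have [? ?] := Goo k.
  split; first exact: measurableX.
  by rewrite product_measure1E// lte_mul_pinfty// ge0_fin_numE.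
pose uncons (v : N.+1.-tuple (measurableTypeR R)) :=
  (thead v : measurableTypeR R, [tuple of behead v] : N.-tuple (measurableTypeR R)).
have consK : cancel cons_map uncons.
  by move=> [x v]; rewrite /uncons /cons_map/= theadE; congr pair; exact/val_inj.
have unconsK : cancel uncons cons_map.
  by move=> v; rewrite /cons_map/= -tuple_eta.
have muncons : measurable_fun setT uncons.
  apply/measurable_fun_pair; first exact: measurable_tnth.
  exact: measurable_behead.
exists (fun n => uncons @^-1` F n).
  by apply/seteqP; split => // v _; have : [set: _] (uncons v) by []; rewrite FT.
move=> n; have [mFn Fn] := Ffin n; split.
  by rewrite -[X in measurable X]setTI; exact: muncons.
rewrite /lebesgue_cons /pushforward (_ : _ @^-1` _ = F n)//.
by apply/seteqP; split => z /=; rewrite consK.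
Qed.

HB.instance Definition _ := Measure_isSigmaFinite.Build _ _ _ lebesgue_cons
  lebesgue_cons_sigma_finite.

End lebesgue_tuple_succ.

Fixpoint lebesgue_tuple N :
    {sigma_finite_measure set (N.-tuple (measurableTypeR R)) -> \bar R} :=
  match N with
  | 0 => dirac [tuple]
  | N'.+1 => lebesgue_cons (lebesgue_tuple N')
  end.

Local Close Scope ereal_scope.

Definition Gamma (x : R) : R :=
  \int[lebesgue_measure]_(s in `]0, +oo[) (s `^ (x - 1) * expR (- s)).

Definition simplex N : set (N.-tuple (measurableTypeR R)) :=
  [set x | sorted <%R (knots 0 1 x)].

Definition gap (x : seq R) (i : nat) : R :=
  nth 0 (knots 0 1 x) i.+1 - nth 0 (knots 0 1 x) i.

(* The interior points t_1 < ... < t_N of a partition of [0, 1] are exactly the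
   points of [simplex N]. The test function [u] is taken on R^N, as only its
   values on [0, 1]^N matter. *)
Definition entropic_on_G0 (beta : R) (Q : Prob R (@dL2 R)) :=
  forall (N : nat) (t : N.-tuple I) (u : N.-tuple (measurableTypeR R) -> R),
    let tau := map_tuple (fun s : I => s%:num) t in
    simplex tau ->
    measurable_fun [set: N.-tuple (measurableTypeR R)] u ->
    (exists M, forall x, `|u x| <= M) ->
    (\int[Q]_g (u (map_tuple (fun s => (right_cont_repr g s)%:num) t))%:E =
    (Gamma beta / \prod_(i < N.+1) Gamma (beta * gap tau i))%:E *
    \int[lebesgue_tuple N]_(x in simplex (N := N))
      (u x * \prod_(i < N.+1) gap x i `^ (beta * gap tau i - 1))%:E)%E.

End entropic_measure.

(* Main.v *)
Require Import Defs.
From HB Require Import structures.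
From mathcomp Require Import all_boot all_order all_algebra.
From mathcomp Require Import all_classical all_reals all_analysis.
From mathcomp Require Import measurable_realfun ring lra.

Set Implicit Arguments.
Unset Strict Implicit.
Unset Printing Implicit Defensive.

Import Order.TTheory GRing.Theory Num.Theory.
Import numFieldNormedType.Exports.

Local Open Scope classical_set_scope.
Local Open Scope ring_scope.

(** Quantile functions identify the space of probability measures on [0, 1]
    with a convex subset of L2, so that midpoints are averages (g + h) / 2 of
    quantile functions. Under the entropic measure m the value g(t) has a Beta
    law, with density proportional to x ^ (beta t - 1) near 0. For small t this
    has a pole at 0, so it is log-convex where a lower Ricci bound would want
    log-concavity.

    The contradiction is of Brunn-Minkowski type. Take 0 < s < t < u and small
    e > 0, and let A0 be the event g(u) < e, let A1 be the event that g stays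
    within e of 1/2 on [s, u[, and let B be the event that g(t) is within 2 e of
    1/4. The average of an element of A0 and an element of A1 is close to 1/4 on
    the whole of [s, u[, so its value at t puts it in B. A lower Ricci bound,
    applied to m conditioned on A0 and on A1, therefore gives
      m(B) >= c sqrt (m(A0) m(A1))
    where c does not depend on e, because the diameter of the space is at most
    1. But m(B) is at most of order e ([mass_mid]), whereas m(A0) is at least of
    order e ^ (beta u) ([mass_low]) and m(A1) at least of order
    e ^ (1 + beta (u - s)) ([mass_flat]). Once beta u + beta (u - s) < 1 the
    geometric mean of the last two dominates e, and e -> 0 is absurd.

    Three points need work. The midpoint of a geodesic between measures
    carried by A0 and by A1 must charge B only ([midpoint_concentration]).
    Optimal couplings and disintegrations are avoided: near-optimal couplings
    of the two halves of the geodesic are glued along a finite partition into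
    small cells, and the parallelogram identity shows that a middle point
    outside B costs a fixed amount. Next, the L2 geometry has to be transported
    to the Wasserstein distance: monotone couplings are optimal
    ([wasserstein_Psi]) and every measure has a quantile function
    ([Psi_surjective]). Finally, the entropy of a measure carried by B is
    bounded below by integrating a tangent line of r ln r ([entropy_ge]). *)

(** * Integrals of bounded measurable functions *)

Lemma inv_nat_lt (R : realType) (e : R) : 0 < e -> exists n : nat, n.+1%:R^-1 < e.
Proof.
move=> e0; exists `|Num.ceil (e^-1)|%N.
rewrite -[ltRHS]invrK ltf_pV2 ?posrE ?invr_gt0//.
rewrite (le_lt_trans (ceil_ge _))//.
have c0 : (0 <= Num.ceil (e^-1))%R.
  by rewrite ceil_ge0 (lt_trans (ltrN10 _))// invr_gt0.
by rewrite -{1}(gez0_abs c0) -[_%:~R]/(_%:R) ltr_nat.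
Qed.

Section bounded_measurable.
Context d (T : measurableType d) (R : realType).
Implicit Types f g : T -> R.

(** Boundedness makes a function integrable for every finite measure, and the
    class is closed under the algebraic operations; this is all the
    integrability theory that is needed. *)
Definition bmfun f := measurable_fun [set: T] f /\ exists M, forall x, `|f x| <= M.

Lemma bmfun_cst c : bmfun (fun=> c).
Proof. by split=> //; exists `|c|. Qed.

Lemma bmfunD f g : bmfun f -> bmfun g -> bmfun (fun x => f x + g x).
Proof.
move=> [mf [M fM]] [mg [N gN]]; split; first exact: measurable_funD.
by exists (M + N) => x; rewrite (le_trans (ler_normD _ _))// lerD.
Qed.

Lemma bmfunB f g : bmfun f -> bmfun g -> bmfun (fun x => f x - g x).
Proof.
move=> [mf [M fM]] [mg [N gN]]; split; first exact: measurable_funB.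
by exists (M + N) => x; rewrite (le_trans (ler_normB _ _))// lerD.
Qed.

Lemma bmfunM f g : bmfun f -> bmfun g -> bmfun (fun x => f x * g x).
Proof.
move=> [mf [M fM]] [mg [N gN]]; split; first exact: measurable_funM.
by exists (M * N) => x; rewrite normrM ler_pM.
Qed.

Lemma bmfunX f n : bmfun f -> bmfun (fun x => f x ^+ n).
Proof.
move=> bf; elim: n => [|n IH]; first exact: bmfun_cst.
rewrite (_ : (fun x => f x ^+ n.+1) = (fun x => f x * f x ^+ n)).
  exact: bmfunM.
by apply/funext => x; rewrite exprS.
Qed.

Lemma bmfun_sum (I : Type) (r : seq I) (F : I -> T -> R) :
  (forall i, bmfun (F i)) -> bmfun (fun x => \sum_(i <- r) F i x).
Proof.
move=> bF; elim: r => [|i r IH].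
  rewrite (_ : (fun _ => _) = fun=> 0); first exact: bmfun_cst.
  by apply/funext => x; rewrite big_nil.
rewrite (_ : (fun _ => _) = fun x => F i x + \sum_(j <- r) F j x).
  exact: bmfunD.
by apply/funext => x; rewrite big_cons.
Qed.

Lemma bmfun_indic A : measurable A -> bmfun (\1_A).
Proof.
move=> mA; split=> //; exists 1 => x.
by rewrite indicE; case: (_ \in _); rewrite ?normr1 ?normr0.
Qed.

Variable mu : {finite_measure set T -> \bar R}.

Lemma bmfun_integrable f D : measurable D -> bmfun f -> mu.-integrable D (EFin \o f).
Proof.
move=> mD [mf [M fM]]; apply: measurable_bounded_integrable => //.
- by rewrite -ge0_fin_numE// fin_num_measure.
- exact: measurable_funTS.
- exists M; split; first exact: num_real.
  by move=> N MN x _ /=; rewrite (le_trans (fM x))// ltW.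
Qed.

Lemma Rint_D f g : bmfun f -> bmfun g ->
  \int[mu]_x (f x + g x) = \int[mu]_x f x + \int[mu]_x g x.
Proof. by move=> *; apply: RintegralD => //; exact: bmfun_integrable. Qed.

Lemma Rint_B f g : bmfun f -> bmfun g ->
  \int[mu]_x (f x - g x) = \int[mu]_x f x - \int[mu]_x g x.
Proof. by move=> *; apply: RintegralB => //; exact: bmfun_integrable. Qed.

Lemma Rint_Z c f : bmfun f -> \int[mu]_x (c * f x) = c * \int[mu]_x f x.
Proof. by move=> *; apply: RintegralZl => //; exact: bmfun_integrable. Qed.

Lemma Rint_le f g : bmfun f -> bmfun g -> (forall x, f x <= g x) ->
  \int[mu]_x f x <= \int[mu]_x g x.
Proof.
by move=> bf bg fg; apply: le_Rintegral => //; exact: bmfun_integrable.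
Qed.

Lemma Rint_indic A : measurable A -> \int[mu]_x \1_A x = fine (mu A).
Proof. by move=> mA; rewrite /Rintegral integral_indic// setIT. Qed.

Lemma Rint_sum (I : Type) (r : seq I) (F : I -> T -> R) :
  (forall i, bmfun (F i)) ->
  \int[mu]_x (\sum_(i <- r) F i x) = \sum_(i <- r) \int[mu]_x F i x.
Proof.
move=> bF; elim: r => [|i r IH].
  rewrite big_nil -[RHS](mul0r (fine (mu setT))) -Rintegral_cst//.
  by apply: eq_Rintegral => x _; rewrite big_nil.
rewrite big_cons -IH -Rint_D//; last exact: bmfun_sum.
by apply: eq_Rintegral => x _; rewrite big_cons.
Qed.

Lemma Rint_EFin f : bmfun f -> (\int[mu]_x f x)%:E = (\int[mu]_x (f x)%:E)%E.
Proof.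
move=> bf; rewrite /Rintegral fineK//.
exact/integrable_fin_num/bmfun_integrable.
Qed.

End bounded_measurable.

Lemma Rint_cst d (T : measurableType d) (R : realType) (P : probability T R) (c : R) :
  \int[P]_x c = c.
Proof.
have f1 : fine (P setT) = 1 by rewrite probability_setT.
by rewrite Rintegral_cst//; transitivity (c * 1); [congr (c * _)|rewrite mulr1].
Qed.

Lemma bmfun_comp d d' (T : measurableType d) (U : measurableType d') (R : realType)
  (f : U -> R) (h : T -> U) : measurable_fun setT h -> bmfun f ->
  bmfun (fun x => f (h x)).
Proof.
by move=> mh [mf [M fM]]; split; [exact: measurableT_comp mf mh|exists M].
Qed.

(** * Densities, image laws and product measures *)

(** The proofs are bundled with the density so that the measure [dens] below is
    canonically a probability. *)
Record pdensity d (T : measurableType d) (R : realType) (P : probability T R) :=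
  PDensity {
    pdensity_fun :> T -> R ;
    pdensity_bmfun : bmfun pdensity_fun ;
    pdensity_ge0 : forall x, 0 <= pdensity_fun x ;
    pdensity_int : \int[P]_x pdensity_fun x = 1 }.

Section density_measure.
Context d (T : measurableType d) (R : realType) (P : probability T R).
Variable w : pdensity P.

Definition dens (A : set T) : \bar R := (\int[P]_(x in A) (w x)%:E)%E.

Let mw : measurable_fun [set: T] (EFin \o w).
Proof. by apply/measurable_EFinP; case: (pdensity_bmfun w). Qed.

Let dens0 : dens set0 = 0%E.
Proof. by rewrite /dens integral_set0. Qed.

Let dens_ge0 A : (0 <= dens A)%E.
Proof. by apply: integral_ge0 => x _; rewrite lee_fin pdensity_ge0. Qed.

Let dens_sigma_additive : semi_sigma_additive dens.
Proof.
by apply: semi_sigma_additive_nng_induced => // x; rewrite lee_fin pdensity_ge0.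
Qed.

HB.instance Definition _ := isMeasure.Build _ _ _ dens
  dens0 dens_ge0 dens_sigma_additive.

Let dens_setT : dens [set: T] = 1%E.
Proof. by rewrite /dens -Rint_EFin ?pdensity_int//; exact: pdensity_bmfun. Qed.

HB.instance Definition _ := Measure_isProbability.Build _ _ _ dens dens_setT.

Lemma dens_dominates : dens `<< P.
Proof.
apply/null_content_dominatesP => A mA PA0; apply: null_set_integral => //.
  exact: measurable_funTS.
Qed.

(** A density is determined almost everywhere by its integrals over all
    measurable sets. *)
Lemma Radon_Nikodym_dens :
  ae_eq P setT (EFin \o w) (Radon_Nikodym (charge_of_finite_measure dens) P).
Proof.
apply: integral_ae_eq => //.
- exact: bmfun_integrable (pdensity_bmfun w).
- by apply: measurable_int (Radon_Nikodym_integrable _); exact: dens_dominates.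
- move=> A _ mA; rewrite -Radon_Nikodym_integral//; exact: dens_dominates.
Qed.

Lemma Rint_dens (f : T -> R) : bmfun f ->
  \int[dens]_x f x = \int[P]_x (w x * f x).
Proof.
move=> bf; congr fine.
rewrite -(@Radon_Nikodym_change_of_variables _ _ _ dens P dens_dominates)//; last first.
  exact: bmfun_integrable.
apply: ae_eq_integral => //.
- apply: emeasurable_funM; first by apply/measurable_EFinP; case: bf.
  by apply: measurable_int (Radon_Nikodym_integrable _); exact: dens_dominates.
- apply/measurable_EFinP.
  by case: (bmfunM (pdensity_bmfun w) bf).
- under [X in ae_eq _ _ _ X]eq_fun do rewrite mulrC EFinM.
  apply: ae_eqe_mul2l; apply: ae_eq_sym.
  exact: Radon_Nikodym_dens.
Qed.

End density_measure.

Section law.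
Context d d' (T : measurableType d) (U : measurableType d') (R : realType).
Variables (P : probability T R) (h : T -> U) (mh : measurable_fun setT h).

Let mh_mixin := isMeasurableFun.Build _ _ _ _ h mh.
Let mh_pack : {mfun T >-> U} := HB.pack h mh_mixin.

Definition law : probability U R := distribution P mh_pack.

Lemma lawE A : law A = P (h @^-1` A).
Proof. by []. Qed.

Lemma Rint_law (f : U -> R) : bmfun f -> \int[law]_y f y = \int[P]_x f (h x).
Proof.
move=> bf; congr fine; apply: integral_distribution.
  by apply/measurable_EFinP; case: bf.
by apply: (bmfun_integrable P measurableT (f := f \o h)); apply: bmfun_comp bf.
Qed.

End law.

Section product_Rint.
Context d d' (T : measurableType d) (U : measurableType d') (R : realType).
Variables (P : probability T R) (Q : probability U R).

Definition prodP : probability (T * U)%type R := (P \x Q)%E.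

Lemma prodPE A B : measurable A -> measurable B -> prodP (A `*` B) = (P A * Q B)%E.
Proof. by move=> mA mB; rewrite /prodP/= product_measure1E. Qed.

Lemma Rint_prod (f : T -> R) (g : U -> R) : bmfun f -> bmfun g ->
  \int[prodP]_z (f z.1 * g z.2) = (\int[P]_x f x) * (\int[Q]_y g y).
Proof.
move=> bf bg.
have bfg : @bmfun _ (T * U)%type R (fun z : T * U => f z.1 * g z.2).
  apply: bmfunM; first exact: bmfun_comp measurable_fst bf.
  exact: bmfun_comp measurable_snd bg.
have ifg := bmfun_integrable prodP measurableT bfg.
have := integral12_prod_meas1 ifg.
rewrite /Rintegral -/prodP.
move=> <-.
set a := fine (\int[Q]_y _).
transitivity (\int[P]_x (f x * a)).
  congr fine; apply: eq_integral => x _ /=.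
  rewrite /fubini_F /= EFinM /a -/(Rintegral Q setT g) Rint_EFin//.
  rewrite -integralZl//; exact: bmfun_integrable.
by rewrite RintegralZr//; exact: bmfun_integrable.
Qed.

End product_Rint.

(** * Borel sets of totally bounded pseudometric spaces *)

(** The Wasserstein distance is only a pseudometric: measures that agree on
    Borel sets need not be equal. The bound 1 keeps all costs finite, and finite
    nets replace compactness; the nets also force d x x = 0. *)
Record tb_pseudometric (R : realType) (X : pointedType) (d : X -> X -> R) : Prop :=
  TbPseudometric {
    tb_ge0 : forall x y, 0 <= d x y ;
    tb_C : forall x y, d x y = d y x ;
    tb_triangle : forall x y z, d x z <= d x y + d y z ;
    tb_le1 : forall x y, d x y <= 1 ;
    tb_net : forall e, 0 < e ->
      exists s : seq X, forall x, exists2 c, c \in s & d c x < e }.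

Section pseudometric_borel.
Context (R : realType) (X : pointedType) (d : X -> X -> R).
Hypothesis dP : tb_pseudometric d.

Lemma measurable_metric_open (U : set X) : metric_open d U ->
  measurable (U : set (borel d)).
Proof. exact: sub_sigma_algebra. Qed.

Lemma metric_open_ball c e : metric_open d [set y | d c y < e].
Proof.
move=> x /= cx; exists (e - d c x); first by rewrite subr_gt0.
move=> y /= xy; have := tb_triangle dP c x y; lra.
Qed.

Lemma measurable_fst_dist_prod :
  measurable_fun setT (fst : borel (dist_prod d) -> borel d).
Proof.
apply: (@measurability _ _ _ (borel d) _ _ (metric_open d)) => // _ [U oU <-].
rewrite setTI; apply: sub_sigma_algebra => z /= /oU [e e0 he].
by exists e => // w /=; rewrite /dist_prod gt_max => /andP[h _]; exact: he.
Qed.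

Lemma measurable_snd_dist_prod :
  measurable_fun setT (snd : borel (dist_prod d) -> borel d).
Proof.
apply: (@measurability _ _ _ (borel d) _ _ (metric_open d)) => // _ [U oU <-].
rewrite setTI; apply: sub_sigma_algebra => z /= /oU [e e0 he].
by exists e => // w /=; rewrite /dist_prod gt_max => /andP[_ h]; exact: he.
Qed.

Lemma bmfun_dist :
  @bmfun _ (borel (dist_prod d)) R (fun z : X * X => d z.1 z.2).
Proof.
split; last by exists 1 => z; rewrite ger0_norm ?(tb_ge0 dP)// (tb_le1 dP).
apply: (measurability _ (RGenOInfty.measurableE R)) => //.
move=> /= _ [_ [c ->] <-]; rewrite setTI; apply: sub_sigma_algebra => z /=.
rewrite in_itv/= andbT => cz.
exists ((d z.1 z.2 - c) / 2); first by rewrite divr_gt0// subr_gt0.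
move=> w /=; rewrite in_itv/= andbT /dist_prod gt_max => /andP[h1 h2].
have := tb_triangle dP z.1 w.1 z.2; have := tb_triangle dP w.1 w.2 z.2.
by rewrite (tb_C dP w.2); lra.
Qed.

Definition to_borel_prod (z : borel d * borel d) : borel (dist_prod d) := z.

(** The nets provide a countable base, hence an open set of the product is a
    countable union of products of balls. *)
Lemma measurable_to_borel_prod : measurable_fun setT to_borel_prod.
Proof.
apply: (@measurability _ _ _ (borel (dist_prod d)) _ _
  (metric_open (dist_prod d))) => // _ [U oU <-]; rewrite setTI.
have [eps [eps0 epsP]] : exists eps : nat -> R,
    (forall n, 0 < eps n) /\ (forall e, 0 < e -> exists n, eps n < e / 2).
  exists (fun n => n.+1%:R^-1); split => [n|e e0]; first by rewrite invr_gt0.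
  by apply: inv_nat_lt; rewrite divr_gt0.
have /boolp.choice[s sP] : forall n : nat, exists s : seq X,
    forall x, exists2 c, c \in s & d c x < eps n.
  by move=> n; exact: (tb_net dP).
pose B n i := [set x | d (nth point (s n) i) x < eps n].
have -> : to_borel_prod @^-1` U =
    \bigcup_n \bigcup_i \bigcup_j
      (if `[< B n i `*` B n j `<=` U >] then B n i `*` B n j else set0).
  apply/seteqP; split => [z /= Uz|z [n _ [i _ [j _]]]]; last first.
    by case: asboolP => // BU /BU.
  have [e e0 he] := oU _ Uz.
  have [n ne] := epsP e e0.
  have [c1 c1s hc1] := sP n z.1.
  have [c2 c2s hc2] := sP n z.2.
  have z1 : B n (index c1 (s n)) z.1 by rewrite /B/= nth_index.
  have z2 : B n (index c2 (s n)) z.2 by rewrite /B/= nth_index.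
  exists n => //; exists (index c1 (s n)) => //; exists (index c2 (s n)) => //.
  rewrite asboolT// => w [/= w1 w2]; apply: he => /=.
  rewrite /dist_prod gt_max; apply/andP; split.
    have := tb_triangle dP z.1 c1 w.1; rewrite (tb_C dP z.1 c1).
    by move: w1; rewrite /B/= nth_index//; lra.
  have := tb_triangle dP z.2 c2 w.2; rewrite (tb_C dP z.2 c2).
  by move: w2; rewrite /B/= nth_index//; lra.
have mB n i : measurable (B n i : set (borel d)).
  by apply: measurable_metric_open; exact: metric_open_ball.
apply: bigcup_measurable => n _; apply: bigcup_measurable => i _.
apply: bigcup_measurable => j _; case: ifPn => _ //.
by apply: measurableX.
Qed.

(** The balls around a finite net, each deprived of the previous ones. *)
Lemma small_cells (dlt : R) : 0 < dlt -> exists n (C : nat -> set (borel d)),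
  [/\ forall k, measurable (C k),
      forall x, \sum_(k < n) \1_(C k) x = 1 :> R
    & forall k x y, C k x -> C k y -> d x y < dlt].
Proof.
move=> dlt0; have d20 : 0 < dlt / 2 by rewrite divr_gt0.
have [s sP] := tb_net dP d20.
pose B i := [set x : borel d | d (nth point s i) x < dlt / 2].
have mB i : measurable (B i).
  by apply: measurable_metric_open; exact: metric_open_ball.
pose C k : set (borel d) := B k `\` \big[setU/set0]_(i < k) B i.
exists (size s), C; split => [k|x|k x y [xk _] [yk _]].
- by apply: measurableD => //; exact: bigsetU_measurable.
- have hx : exists i, (i < size s)%N && `[< B i x >].
    have [c cs cx] := sP x; exists (index c s).
    by rewrite index_mem cs/=; apply/asboolP; rewrite /B/= nth_index.
  case: (ex_minnP hx) => m /andP[ms /asboolP Bm] mmin.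
  rewrite (bigD1 (Ordinal ms))//= big1 ?addr0.
    rewrite indicE mem_set//; split => //; rewrite -bigcup_mkord => -[i /= im Bi].
    by have := mmin i; rewrite (ltn_trans im ms) asboolT// leqNgt im => /(_ isT).
  move=> i im; rewrite indicE memNset// => -[Bi Ni].
  have := mmin i; rewrite ltn_ord asboolT//= => /(_ isT); rewrite leq_eqVlt.
  case/orP => [/eqP mi|mi]; first by move/eqP : im; apply; apply: val_inj.
  by apply: Ni; rewrite -bigcup_mkord; exists m.
- have := tb_triangle dP x (nth point s k) y.
  by rewrite (tb_C dP x (nth point s k)); move: xk yk; rewrite /B/=; lra.
Qed.

End pseudometric_borel.

(** * Transport costs and gluing of couplings *)

Section wasserstein_cost.
Context (R : realType) (X : pointedType) (d : X -> X -> R).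
Hypothesis dP : tb_pseudometric d.
Implicit Types mu nu : Prob R d.

Definition cost (pi : Prob R (dist_prod d)) : R := \int[pi]_z (d z.1 z.2 ^+ 2).

Lemma bmfun_dist2 :
  @bmfun _ (borel (dist_prod d)) R (fun z : X * X => d z.1 z.2 ^+ 2).
Proof. exact/bmfunX/bmfun_dist. Qed.

Let costs mu nu :=
  [set (\int[pi]_z (d z.1 z.2 ^+ 2)%:E)%E | pi in coupling mu nu].

Lemma cost_EFin (pi : Prob R (dist_prod d)) :
  (\int[pi]_z (d z.1 z.2 ^+ 2)%:E)%E = (cost pi)%:E.
Proof. by rewrite /cost Rint_EFin//; exact: bmfun_dist2. Qed.

Lemma product_coupling mu nu :
  coupling mu nu (law (prodP mu nu) (measurable_to_borel_prod dP)).
Proof.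
have mT := @measurableT _ (borel d).
move=> A mA; split.
- transitivity (prodP mu nu (A `*` setT)).
    rewrite lawE; congr (prodP mu nu _).
    by apply/seteqP; split => z //= -[].
  by rewrite prodPE// probability_setT mule1.
- transitivity (prodP mu nu (setT `*` A)).
    rewrite lawE; congr (prodP mu nu _).
    by apply/seteqP; split => z //= -[].
  by rewrite prodPE// probability_setT mul1e.
Qed.

Let inf_ge0 mu nu : (0 <= ereal_inf (costs mu nu))%E.
Proof.
apply: le_ereal_inf_tmp => _ [pi _ <-].
by apply: integral_ge0 => z _; rewrite lee_fin sqr_ge0.
Qed.

Let inf_fin mu nu : ereal_inf (costs mu nu) \is a fin_num.
Proof.
rewrite ge0_fin_numE//; apply: le_lt_trans (ltry (cost
  (law (prodP mu nu) (measurable_to_borel_prod dP)))).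
apply: ereal_inf_lbound; eexists; first exact: product_coupling.
by rewrite cost_EFin.
Qed.

Lemma wasserstein_sqrE mu nu :
  ((wasserstein d mu nu) ^+ 2)%:E = ereal_inf (costs mu nu).
Proof.
rewrite /wasserstein sqr_sqrtr; last exact/fine_ge0/inf_ge0.
exact/fineK/inf_fin.
Qed.

Lemma wasserstein_le_cost mu nu pi : coupling mu nu pi ->
  wasserstein d mu nu ^+ 2 <= cost pi.
Proof.
move=> cpi; rewrite -lee_fin wasserstein_sqrE; apply: ereal_inf_lbound.
by exists pi => //; rewrite cost_EFin.
Qed.

(** The infimum is finite, because the product coupling competes. *)
Lemma wasserstein_near_optimal mu nu e : 0 < e ->
  exists2 pi, coupling mu nu pi & cost pi < wasserstein d mu nu ^+ 2 + e.
Proof.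
move=> e0.
have [_ [pi cpi <-]] := lb_ereal_inf_adherent e0 (inf_fin mu nu).
rewrite -wasserstein_sqrE cost_EFin -EFinD lte_fin => h.
by exists pi.
Qed.

Lemma wasserstein_ge0 mu nu : 0 <= wasserstein d mu nu.
Proof. exact: sqrtr_ge0. Qed.

Lemma wasserstein_le1 mu nu : wasserstein d mu nu <= 1.
Proof.
rewrite -(ler_pXn2r (n := 2))// ?nnegrE ?wasserstein_ge0// expr1n.
rewrite (le_trans (wasserstein_le_cost (product_coupling mu nu)))//.
set pi := law _ _.
have <- : \int[pi]_z (1 : R) = 1 by exact: Rint_cst.
apply: Rint_le.
- exact: bmfun_dist2.
- exact: bmfun_cst.
- by move=> z; rewrite -(expr1n _ 2) ler_pXn2r ?nnegrE ?(tb_ge0 dP)// (tb_le1 dP).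
Qed.

End wasserstein_cost.

Section coupling_Rint.
Context (R : realType) (X : pointedType) (d : X -> X -> R).
Variables (mu nu : Prob R d) (pi : Prob R (dist_prod d)).
Hypothesis cpi : coupling mu nu pi.

Lemma Rint_coupling_fst (f : borel d -> R) : bmfun f ->
  \int[pi]_z f z.1 = \int[mu]_x f x.
Proof.
move=> bf.
transitivity (\int[law pi (measurable_fst_dist_prod (d := d))]_x f x).
  by rewrite Rint_law.
congr fine; apply: eq_measure_integral => A mA _.
by rewrite [LHS]lawE; exact: (cpi mA).1.
Qed.

Lemma Rint_coupling_snd (f : borel d -> R) : bmfun f ->
  \int[pi]_z f z.2 = \int[nu]_x f x.
Proof.
move=> bf.
transitivity (\int[law pi (measurable_snd_dist_prod (d := d))]_x f x).
  by rewrite Rint_law.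
congr fine; apply: eq_measure_integral => A mA _.
by rewrite [LHS]lawE; exact: (cpi mA).2.
Qed.

End coupling_Rint.

Section gluing.
Context (R : realType) (X : pointedType) (d : X -> X -> R).
Hypothesis dP : tb_pseudometric d.
Variables (mu0 mu1 mu2 : Prob R d) (pi01 pi12 : Prob R (dist_prod d)).
Hypotheses (c01 : coupling mu0 mu1 pi01) (c12 : coupling mu1 mu2 pi12).
Variables (n : nat) (C : nat -> set (borel d)).
Hypotheses (mC : forall k, measurable (C k))
  (sumC : forall x, \sum_(k < n) \1_(C k) x = 1 :> R).

Local Notation Y := (borel (dist_prod d)).

Let p k : R := fine (mu1 (C k)).
Let b1 k : @bmfun _ Y R (fun z => \1_(C k) z.2).
Proof.
by apply: (bmfun_comp (measurable_snd_dist_prod (d := d))); exact: bmfun_indic.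
Qed.
Let b2 k : @bmfun _ Y R (fun z => \1_(C k) z.1).
Proof.
by apply: (bmfun_comp (measurable_fst_dist_prod (d := d))); exact: bmfun_indic.
Qed.

Let p1 k : \int[pi01]_z (\1_(C k) z.2) = p k.
Proof.
rewrite /p -(c01 (mC k)).2 -Rint_indic//.
rewrite -[X in measurable X]setTI.
exact: measurable_snd_dist_prod.
Qed.

Let p2 k : \int[pi12]_z (\1_(C k) z.1) = p k.
Proof.
rewrite /p -(c12 (mC k)).1 -Rint_indic//.
rewrite -[X in measurable X]setTI.
exact: measurable_fst_dist_prod.
Qed.

(** A density with respect to the product of [pi01] and [pi12]: the middle
    points of the two pairs are required to lie in the same cell, and given the
    cell the two pairs are independent. Null cells disappear since the inverse
    of 0 is 0. *)
Definition glue_weight (o : Y * Y) : R :=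
  \sum_(k < n) (p k)^-1 * (\1_(C k) o.1.2 * \1_(C k) o.2.1).

Let bmfun_glue_weight : bmfun glue_weight.
Proof.
apply: bmfun_sum => k; apply: bmfunM; first exact: bmfun_cst.
apply: bmfunM.
  by apply: (bmfun_comp (h := fst) _ (b1 k)).
by apply: (bmfun_comp (h := snd) _ (b2 k)).
Qed.

Let glue_weight_ge0 o : 0 <= glue_weight o.
Proof.
by apply: sumr_ge0 => k _; rewrite mulr_ge0// invr_ge0 fine_ge0.
Qed.

Let P := prodP pi01 pi12.

Let Rint_glue_term (f g : Y -> R) : bmfun f -> bmfun g ->
  \int[P]_o (glue_weight o * (f o.1 * g o.2)) =
  \sum_(k < n) (p k)^-1 * ((\int[pi01]_z (\1_(C k) z.2 * f z)) *
                           (\int[pi12]_z (\1_(C k) z.1 * g z))).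
Proof.
move=> bf bg.
have bt k : bmfun (fun o : Y * Y => (\1_(C k) o.1.2 * f o.1) * (\1_(C k) o.2.1 * g o.2) : R).
  apply: bmfunM.
    by apply: (bmfun_comp (h := fst) _ (bmfunM (b1 k) bf)).
  by apply: (bmfun_comp (h := snd) _ (bmfunM (b2 k) bg)).
transitivity (\int[P]_o (\sum_(k < n)
    (p k)^-1 * ((\1_(C k) o.1.2 * f o.1) * (\1_(C k) o.2.1 * g o.2)))).
  apply: eq_Rintegral => o _; rewrite mulr_suml; apply: eq_bigr => k _; ring.
rewrite Rint_sum; last by move=> k; apply: bmfunM; [exact: bmfun_cst|exact: bt].
apply: eq_bigr => k _; rewrite Rint_Z//; congr (_ * _).
rewrite -Rint_prod//; [exact: bmfunM|exact: bmfunM].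
Qed.

Let norm_le (Q : probability Y R) (h f : Y -> R) : bmfun h -> bmfun f ->
  (forall z, 0 <= h z) -> \int[Q]_z h z = 0 -> \int[Q]_z (h z * f z) = 0.
Proof.
move=> bh bf h0 ih; have [M fM] := bf.2; apply/eqP; rewrite eq_le; apply/andP; split.
  have <- : \int[Q]_z (M * h z) = 0 by rewrite Rint_Z// ih mulr0.
  apply: Rint_le; [exact: bmfunM|by apply: bmfunM => //; exact: bmfun_cst|].
  move=> z; rewrite mulrC ler_wpM2r//; exact: le_trans (ler_norm _) (fM z).
have <- : \int[Q]_z (- M * h z) = 0 by rewrite Rint_Z// ih mulr0.
apply: Rint_le; [by apply: bmfunM => //; exact: bmfun_cst|exact: bmfunM|].
move=> z; rewrite mulrC [leRHS]mulrC [leLHS]mulrC ler_wpM2r//.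
by have := fM z; rewrite ler_norml => /andP[].
Qed.

(** In each cell the second pair integrates to [p k], which cancels the
    normalisation; the cells then add up to the whole space. The same argument
    with the two pairs exchanged gives the next lemma. *)
Lemma Rint_glue_fst (f : Y -> R) : bmfun f ->
  \int[P]_o (glue_weight o * f o.1) = \int[pi01]_z f z.
Proof.
move=> bf.
transitivity (\int[P]_o (glue_weight o * (f o.1 * cst 1 o.2))).
  by apply: eq_Rintegral => o _; rewrite mulr1.
rewrite Rint_glue_term//; last exact: bmfun_cst.
transitivity (\sum_(k < n) \int[pi01]_z (\1_(C k) z.2 * f z)).
  apply: eq_bigr => k _.
  under [X in _ * (_ * X)]eq_Rintegral do rewrite mulr1.
  rewrite p2; have [pk0|pk0] := eqVneq (p k) 0.
    by rewrite pk0 invr0 mul0r norm_le// p1.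
  by rewrite mulrCA mulVf// mulr1.
rewrite -Rint_sum; last by move=> k; exact: bmfunM.
by apply: eq_Rintegral => z _; rewrite -mulr_suml sumC mul1r.
Qed.

Lemma Rint_glue_snd (g : Y -> R) : bmfun g ->
  \int[P]_o (glue_weight o * g o.2) = \int[pi12]_z g z.
Proof.
move=> bg.
transitivity (\int[P]_o (glue_weight o * (cst 1 o.1 * g o.2))).
  by apply: eq_Rintegral => o _; rewrite mul1r.
rewrite Rint_glue_term//; last exact: bmfun_cst.
transitivity (\sum_(k < n) \int[pi12]_z (\1_(C k) z.1 * g z)).
  apply: eq_bigr => k _.
  under [X in _ * (X * _)]eq_Rintegral do rewrite mulr1.
  rewrite p1; have [pk0|pk0] := eqVneq (p k) 0.
    by rewrite pk0 invr0 mul0r norm_le// p2.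
  by rewrite mulrA mulVf// mul1r.
rewrite -Rint_sum; last by move=> k; exact: bmfunM.
by apply: eq_Rintegral => z _; rewrite -mulr_suml sumC mul1r.
Qed.

Lemma glue_weight_int : \int[P]_o glue_weight o = 1.
Proof.
transitivity (\int[P]_o (glue_weight o * cst 1 o.1)).
  by apply: eq_Rintegral => o _; rewrite mulr1.
rewrite Rint_glue_fst; last exact: bmfun_cst.
by exact: Rint_cst.
Qed.

Definition glue_density : pdensity P :=
  PDensity bmfun_glue_weight glue_weight_ge0 glue_weight_int.

Definition glue_ends (o : Y * Y) : Y := to_borel_prod (o.1.1, o.2.2).

Lemma measurable_glue_ends : measurable_fun setT glue_ends.
Proof.
apply: (measurableT_comp (measurable_to_borel_prod dP)).
apply/measurable_fun_pair => /=.
  by apply: (measurableT_comp (measurable_fst_dist_prod (d := d))).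
by apply: (measurableT_comp (measurable_snd_dist_prod (d := d))).
Qed.

Definition glued : Prob R (dist_prod d) :=
  law (dens glue_density) measurable_glue_ends.

Lemma Rint_glued (f : Y -> R) : bmfun f ->
  \int[glued]_z f z = \int[P]_o (glue_weight o * f (glue_ends o)).
Proof.
move=> bf; rewrite Rint_law// Rint_dens//.
exact: bmfun_comp measurable_glue_ends bf.
Qed.

(** Forgetting the middle points leaves the first marginal of [pi01] and the
    second marginal of [pi12]. *)
Lemma glued_coupling : coupling mu0 mu2 glued.
Proof.
move=> A mA; split.
- have mA' : measurable (fst @^-1` A : set Y).
    by rewrite -[X in measurable X]setTI; exact: measurable_fst_dist_prod.
  rewrite -(c01 mA).1 -[LHS]fineK ?fin_num_measure// -[RHS]fineK ?fin_num_measure//.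
  congr EFin; rewrite -!Rint_indic// Rint_glued; last exact: bmfun_indic.
  by rewrite -Rint_glue_fst//; exact: bmfun_indic.
- have mA' : measurable (snd @^-1` A : set Y).
    by rewrite -[X in measurable X]setTI; exact: measurable_snd_dist_prod.
  rewrite -(c12 mA).2 -[LHS]fineK ?fin_num_measure// -[RHS]fineK ?fin_num_measure//.
  congr EFin; rewrite -!Rint_indic// Rint_glued; last exact: bmfun_indic.
  by rewrite -Rint_glue_snd//; exact: bmfun_indic.
Qed.

Lemma glue_weight_neq0 o : glue_weight o != 0 ->
  exists k, C k o.1.2 /\ C k o.2.1.
Proof.
apply: contra_neqP => /forallNP nC; apply: big1 => k _.
rewrite !indicE; have [/set_mem C1|] := boolP (_ \in _); last by rewrite mul0r mulr0.
have [/set_mem C2|] := boolP (_ \in _); last by rewrite !mulr0.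
by case: (nC k).
Qed.

End gluing.

(** * Where Wasserstein midpoints are concentrated *)

Section midpoint.
Context (R : realType) (X : pointedType) (d : X -> X -> R).
Hypothesis dP : tb_pseudometric d.
Variables (A0 A1 B : set (borel d)) (kappa : R).
Hypotheses (mA0 : measurable A0) (mA1 : measurable A1) (mB : measurable B).
Hypothesis kappa0 : 0 < kappa.
Hypothesis far : forall x y z, A0 x -> A1 z -> ~ B y ->
  d x z ^+ 2 + kappa <= 2 * d x y ^+ 2 + 2 * d y z ^+ 2.
Variables mu0 mu1 mu2 : Prob R d.
Hypotheses (mu0A : mu0 (~` A0) = 0%E) (mu2A : mu2 (~` A1) = 0%E).

Local Notation Y := (borel (dist_prod d)).

Lemma dist_sqr_weak x y z : d x z ^+ 2 <= 2 * d x y ^+ 2 + 2 * d y z ^+ 2.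
Proof.
have := tb_triangle dP x y z.
have := tb_ge0 dP x z; have := tb_ge0 dP x y; have := tb_ge0 dP y z.
move: (d x z) (d x y) (d y z) => a b c c0 b0 a0 abc.
have : a ^+ 2 <= (b + c) ^+ 2 by rewrite ler_pXn2r ?nnegrE ?addr_ge0.
by move=> h; apply: le_trans h _; have := sqr_ge0 (b - c); lra.
Qed.

(** The gain [kappa] for a middle point outside [B] is written as a sum of terms
    each of which involves one pair only, (x, y) or (y, z), so that it can be
    integrated against a glued measure with the marginals alone. *)
Lemma dist_sqr_defect x y z :
  d x z ^+ 2 + kappa * ((y \in ~` B)%:R - (x \in ~` A0)%:R) +
    - kappa * (z \in ~` A1)%:R <= 2 * d x y ^+ 2 + 2 * d y z ^+ 2.
Proof.
have w := dist_sqr_weak x y z.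
have [hx|/negP hx] := boolP (x \in ~` A0).
  have k1 : kappa * ((y \in ~` B)%:R - true%:R) <= 0.
    rewrite pmulr_rle0//; case: (_ \in _); rewrite ?subrr// sub0r.
    by rewrite oppr_le0.
  have k2 : - kappa * (z \in ~` A1)%:R <= 0.
    by rewrite mulNr oppr_le0 mulr_ge0// ltW.
  by apply: le_trans w; rewrite -addrA gerDl; have := lerD k1 k2; rewrite addr0.
have [hz|/negP hz] := boolP (z \in ~` A1).
  rewrite subr0 mulr1; apply: le_trans w; rewrite -addrA gerDl subr_le0.
  by rewrite ger_pMr//; case: (_ \in _).
rewrite subr0 mulr0 addr0.
have [/set_mem hy|_] := boolP (y \in ~` B); last by rewrite mulr0 addr0.
by rewrite mulr1; apply: far => //; apply: contrapT => n;
  [apply: hx|apply: hz]; exact: mem_set.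
Qed.

(** In the glued coupling of [mu0] and [mu2] the two middle points are less than
    [dlt] apart, so its cost is controlled by the costs of the two pieces, minus
    [kappa] times the probability that the middle point misses [B]. *)
Lemma gluing_estimate pi01 pi12 dlt : coupling mu0 mu1 pi01 ->
  coupling mu1 mu2 pi12 -> 0 < dlt -> dlt <= 1 ->
  wasserstein d mu0 mu2 ^+ 2 + kappa * fine (mu1 (~` B)) <=
  2 * cost pi01 + 2 * cost pi12 + 6 * dlt.
Proof.
move=> c01 c12 dlt0 dlt1.
have [n [C [mC sumC diamC]]] := small_cells dP dlt0.
pose W := glue_weight mu1 n C.
have mAC (A : set (borel d)) : measurable A -> measurable (~` A).
  exact: measurableC.
have m1 (A : set (borel d)) : measurable A -> measurable (fst @^-1` A : set Y).
  move=> mA; rewrite -[X in measurable X]setTI; exact: measurable_fst_dist_prod.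
have m2 (A : set (borel d)) : measurable A -> measurable (snd @^-1` A : set Y).
  move=> mA; rewrite -[X in measurable X]setTI; exact: measurable_snd_dist_prod.
have cst_bm c : @bmfun _ Y R (fun=> c) by exact: bmfun_cst.
pose F (z : Y) : R := kappa * (\1_(snd @^-1` (~` B)) z - \1_(fst @^-1` (~` A0)) z).
have bF : bmfun F.
  apply: bmfunM => //; apply: bmfunB; apply: bmfun_indic.
    by apply: m2; exact: mAC.
  by apply: m1; exact: mAC.
pose G (z : Y) : R := - kappa * \1_(snd @^-1` (~` A1)) z.
have bG : bmfun G.
  apply: bmfunM => //; apply: bmfun_indic.
  by apply: m2; exact: mAC.
pose u (z : Y) : R := 2 * d z.1 z.2 ^+ 2.
have bu : bmfun u by apply: bmfunM => //; exact: bmfun_dist2.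
have iF : \int[pi01]_z F z = kappa * fine (mu1 (~` B)).
  rewrite Rint_Z; last by apply: bmfunB; apply: bmfun_indic; auto.
  rewrite Rint_B; [|by apply: bmfun_indic; auto..].
  rewrite !Rint_indic; [|by auto..].
  have hB := congr1 fine (c01 _ (mAC _ mB)).2.
  have hA := congr1 fine (c01 _ (mAC _ mA0)).1.
  rewrite mu0A/= in hA.
  transitivity (kappa * (fine (mu1 (~` B)) - 0)); last by rewrite subr0.
  by congr (kappa * (_ - _)).
have iG : \int[pi12]_z G z = 0.
  rewrite Rint_Z; last by apply: bmfun_indic; auto.
  rewrite Rint_indic; last by auto.
  have hA := congr1 fine (c12 _ (mAC _ mA1)).2.
  rewrite mu2A/= in hA.
  transitivity (- kappa * 0); last by rewrite mulr0.
  by congr (- kappa * _).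
have iu (pi : Prob R (dist_prod d)) : \int[pi]_z u z = 2 * cost pi.
  by rewrite Rint_Z//; exact: bmfun_dist2.
have cg := glued_coupling dP c01 c12 mC sumC.
have W1 := Rint_glue_fst c01 c12 mC sumC.
have W2 := Rint_glue_snd c01 c12 mC sumC.
apply: (le_trans (y := cost (glued dP c01 c12 mC sumC) + kappa * fine (mu1 (~` B)))).
  by rewrite lerD2r; exact: wasserstein_le_cost.
rewrite /cost Rint_glued; last exact: bmfun_dist2.
rewrite -/(cost pi01) -/(cost pi12) -iF -(addr0 (\int[pi01]_z F z)) -iG.
rewrite -W1// -W2// -!iu -W1// -W2//.
have <- : \int[prodP pi01 pi12]_o (W o * (6 * dlt)) = 6 * dlt.
  rewrite (W1 (fun=> 6 * dlt))//.
  by exact: Rint_cst.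
have bW := pdensity_bmfun (glue_density c01 c12 mC sumC).
have b_1 (f : Y -> R) : bmfun f -> @bmfun _ (Y * Y)%type R (fun o => W o * f o.1).
  by move=> bf; apply: bmfunM => //; apply: bmfun_comp bf.
have b_2 (f : Y -> R) : bmfun f -> @bmfun _ (Y * Y)%type R (fun o => W o * f o.2).
  by move=> bf; apply: bmfunM => //; apply: bmfun_comp bf.
have b_3 : @bmfun _ (Y * Y)%type R
    (fun o => W o * d (glue_ends o).1 (glue_ends o).2 ^+ 2).
  apply: bmfunM => //.
  exact: bmfun_comp (measurable_glue_ends dP) (bmfun_dist2 dP).
have b_4 : @bmfun _ (Y * Y)%type R (fun o => W o * (6 * dlt)).
  by apply: bmfunM => //; exact: bmfun_cst.
rewrite -!Rint_D; [|by repeat (apply: bmfunD || apply: b_1 || apply: b_2)..].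
apply: Rint_le; [by repeat (apply: bmfunD || apply: b_1 || apply: b_2)..|].
move=> o; rewrite -!mulrDr.
have [w0|Wn0] := eqVneq (glue_weight mu1 n C o) 0.
  by rewrite /W !w0 !mul0r.
have W0 : 0 <= W o by exact: (pdensity_ge0 (glue_density c01 c12 mC sumC)).
apply: ler_wpM2l => //.
have [k [Ck1 Ck2]] := glue_weight_neq0 Wn0.
have dy := diamC _ _ _ Ck1 Ck2.
rewrite /u /F /G /glue_ends /to_borel_prod/= !indicE.
move: o Wn0 W0 Ck1 Ck2 dy => [[x y] [y' z]]/= _ _ _ _ dy.
have key := dist_sqr_defect x y z.
have dyz : d y z ^+ 2 <= d y' z ^+ 2 + 3 * dlt.
  have := tb_triangle dP y y' z.
  have := tb_le1 dP y' z; have := tb_ge0 dP y' z; have := tb_ge0 dP y z.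
  move: (d y z) (d y' z) (d y y') dy => a b c cd a0 b0 b1 abc.
  have : a ^+ 2 <= (dlt + b) ^+ 2.
    by rewrite ler_pXn2r ?nnegrE ?addr_ge0 ?(ltW dlt0)//; lra.
  nra.
lra.
Qed.

(** When [mu1] is a midpoint, near-optimal couplings make the right-hand side
    of [gluing_estimate] exceed the squared distance from [mu0] to [mu2] by as
    little as one wishes, so nothing is left for the mass outside [B]. *)
Lemma midpoint_concentration :
  wasserstein d mu0 mu1 = 2^-1 * wasserstein d mu0 mu2 ->
  wasserstein d mu1 mu2 = 2^-1 * wasserstein d mu0 mu2 -> mu1 B = 1%E.
Proof.
move=> w01 w12.
suff q0 : fine (mu1 (~` B)) = 0.
  have := probability_setC mu1 mB.
  rewrite -[X in X = _ -> _]fineK ?fin_num_measure//; last exact: measurableC.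
  rewrite q0 -[mu1 B]fineK ?fin_num_measure// -EFinB => -[h].
  by congr EFin; lra.
apply/eqP; rewrite eq_le fine_ge0// andbT.
apply/ler_addgt0Pr => e e0; rewrite add0r.
pose eta := Num.min 1 (kappa * e / 10).
have eta0 : 0 < eta by rewrite lt_min ltr01/= divr_gt0// mulr_gt0.
have eta1 : eta <= 1 by rewrite ge_min lexx.
have etae : 10 * eta <= kappa * e.
  have : eta <= kappa * e / 10 by rewrite ge_min lexx orbT.
  lra.
have [pi01 c01 h01] := wasserstein_near_optimal dP mu0 mu1 eta0.
have [pi12 c12 h12] := wasserstein_near_optimal dP mu1 mu2 eta0.
have := gluing_estimate c01 c12 eta0 eta1.
move: h01 h12; rewrite w01 w12 => h01 h12 h.
rewrite -(ler_pM2l kappa0); move: h01 h12 h; rewrite !exprMn.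
lra.
Qed.

End midpoint.

(** * Entropy, and the consequence of a Ricci bound at midpoints *)

Lemma measurable_xlnx (R : realType) : measurable_fun [set: R] (fun r : R => r * ln r).
Proof. by apply: measurable_funM => //; exact: measurable_ln. Qed.

(** For r > 0 this is convexity: the left-hand side is the tangent of r ln r at
    [c]. For r <= 0 the convention ln r = 0 keeps it true as soon as the slope
    is nonnegative; a Radon-Nikodym derivative may take such values on a null
    set. *)
Lemma xlnx_tangent (R : realType) (r c : R) : 0 < c -> 0 <= 1 + ln c ->
  r * (1 + ln c) - c <= r * ln r.
Proof.
move=> c0 c1; have [r0|r0] := leP r 0.
  by rewrite (ln0 r0) mulr0; have := mulr_le0_ge0 r0 c1; lra.
have : ln (c / r) <= c / r - 1.
  have := @le_ln1Dx R (c / r - 1); rewrite addrCA subrr addr0; apply.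
  by rewrite ltrBrDl subrr divr_gt0.
rewrite ln_div ?posrE// -(ler_pM2l r0) !mulrBr mulrCA divff ?gt_eqF// mulr1.
lra.
Qed.

Section relative_entropy.
Context (R : realType) (X : pointedType) (d : X -> X -> R).
Variable m : Prob R d.

Section conditioning.
Variable A : set (borel d).
Hypotheses (mA : measurable A) (A0 : 0 < fine (m A)).

Definition cond_fun (x : borel d) : R := (fine (m A))^-1 * \1_A x.

Let cond_bmfun : bmfun cond_fun.
Proof. by apply: bmfunM; [exact: bmfun_cst|exact: bmfun_indic]. Qed.

Let cond_ge0 x : 0 <= cond_fun x.
Proof. by rewrite mulr_ge0// invr_ge0 ltW. Qed.

Let cond_int : \int[m]_x cond_fun x = 1.
Proof. by rewrite Rint_Z ?Rint_indic ?mulVf ?gt_eqF//; exact: bmfun_indic. Qed.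

Definition cond_density : pdensity m := PDensity cond_bmfun cond_ge0 cond_int.

Definition cond_prob : Prob R d := dens cond_density.

Lemma cond_probC : cond_prob (~` A) = 0%E.
Proof.
rewrite /cond_prob/= /dens; apply: integral0_eq => x nAx.
by rewrite /= /cond_fun indicE memNset// mulr0.
Qed.

Lemma entropy_cond_prob : entropy m cond_prob = (- ln (fine (m A)))%:E.
Proof.
have dom : cond_prob `<< m by exact: dens_dominates.
rewrite /entropy asboolT//=.
have RNfin x : Radon_Nikodym (charge_of_finite_measure cond_prob) m x \is a fin_num.
  exact: Radon_Nikodym_fin_num.
have mRN : measurable_fun setT
    (fun x => fine (Radon_Nikodym (charge_of_finite_measure cond_prob) m x)).
  have iRN := @Radon_Nikodym_integrable _ _ _ (charge_of_finite_measure cond_prob) m dom.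
  by apply: measurableT_comp => //; exact: measurable_int iRN.
rewrite -[RHS](_ : (\int[m]_x (cond_fun x * ln (cond_fun x))%:E)%E = _); last first.
  have -> : (fun x => (cond_fun x * ln (cond_fun x))%:E) =
      fun x => ((fine (m A))^-1 * - ln (fine (m A)) * \1_A x)%:E.
    apply/funext => x; congr EFin; rewrite /cond_fun indicE.
    case: (_ \in _); last by rewrite !mulr0 mul0r.
    by rewrite !mulr1 lnV ?posrE.
  rewrite -Rint_EFin; last by apply: bmfunM; [exact: bmfun_cst|exact: bmfun_indic].
  rewrite Rint_Z ?Rint_indic//; last exact: bmfun_indic.
  by congr EFin; rewrite mulrC mulrA mulfV ?gt_eqF// mul1r.
apply: ae_eq_integral => //.
- by apply/measurable_EFinP; apply: (measurableT_comp (@measurable_xlnx R)).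
- apply/measurable_EFinP; apply: (measurableT_comp (@measurable_xlnx R)).
  by case: cond_bmfun.
- apply: (@filterS _ _ (ae_filter_ringOfSetsType m) _ _ _ (Radon_Nikodym_dens cond_density)).
  by move=> x /(_ Logic.I) /= <- _.
Qed.

End conditioning.

(** The tangent at 1 / e is used on [B], where [mu] lives, and the tangent at 1
    elsewhere, where it only costs a constant. Integrating them needs nothing
    but the masses of [B] for [mu] and [m]. *)
Lemma entropy_ge (mu : Prob R d) (B : set (borel d)) (e : R) :
  measurable B -> mu B = 1%E -> 0 < e -> e <= 1 ->
  ((- ln e - fine (m B) / e)%:E <= entropy m mu)%E.
Proof.
move=> mB muB e0 e1; rewrite /entropy; case: asboolP => [dom|]; last by rewrite leey.
set RN := Radon_Nikodym _ m.
have RNfin x : RN x \is a fin_num by exact: Radon_Nikodym_fin_num.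
have iRN : m.-integrable setT RN by exact: Radon_Nikodym_integrable.
have mRN : measurable_fun setT (fun x => fine (RN x)).
  by apply: measurableT_comp => //; exact: measurable_int iRN.
have lne0 : 0 <= - ln e by rewrite oppr_ge0 ln_le0.
pose f x : R := 1 - ln e * \1_B x.
pose c x : R := 1 + (e^-1 - 1) * \1_B x.
have bB := bmfun_indic R mB.
have bf : bmfun f.
  by apply: bmfunB; [exact: bmfun_cst|apply: bmfunM => //; exact: bmfun_cst].
have bc : bmfun c.
  by apply: bmfunD; [exact: bmfun_cst|apply: bmfunM => //; exact: bmfun_cst].
pose u x := fine (RN x) * f x - c x.
pose v x := fine (RN x) * ln (fine (RN x)).
have uv x : u x <= v x.
  rewrite /u /f /c indicE; case: (_ \in _); rewrite ?mulr1 ?mulr0 ?subr0 ?addr0.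
    rewrite (_ : 1 + (e^-1 - 1) = e^-1); last by ring.
    rewrite -lnV ?posrE//; apply: xlnx_tangent; rewrite ?invr_gt0//.
    by rewrite lnV ?posrE// addr_ge0.
  by have := @xlnx_tangent R (fine (RN x)) 1; rewrite ln1 addr0; apply.
have fRN : (fun x => (fine (RN x) * f x)%:E) = (fun x => (f x)%:E * RN x)%E.
  by apply/funext => x; rewrite mulrC EFinM fineK.
have ifRN : (\int[m]_x (fine (RN x) * f x)%:E = (1 - ln e)%:E)%E.
  rewrite fRN Radon_Nikodym_change_of_variables//; last exact: bmfun_integrable.
  rewrite -Rint_EFin//; congr EFin.
  rewrite Rint_B; [|exact: bmfun_cst|by apply: bmfunM => //; exact: bmfun_cst].
  rewrite Rint_Z// Rint_indic//; congr (_ - _).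
    by exact: Rint_cst.
  by rewrite -[RHS]mulr1; congr (_ * _); rewrite -[RHS]/(fine 1%E) -muB.
have integfRN : m.-integrable setT (fun x => (fine (RN x) * f x)%:E).
  apply/integrableP; split.
    by apply/measurable_EFinP; apply: measurable_funM => //; case: bf.
  have [M fM] := bf.2.
  apply: (@le_lt_trans _ _ (\int[m]_x (M%:E * `|RN x|))%E).
    apply: ge0_le_integral => //.
    - apply: measurableT_comp => //; apply/measurable_EFinP.
      by apply: measurable_funM => //; case: bf.
    - apply: measurable_funeM; apply: measurableT_comp => //.
      exact: measurable_int iRN.
    - move=> x _; rewrite -[X in (_ <= _ * `|X|)%E]fineK//= lee_fin normrM mulrC.
      by rewrite ler_wpM2r.
  have M0 : 0 <= M by exact: le_trans (fM point).
  rewrite ge0_integralZl//.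
  - by rewrite lte_mul_pinfty//; case/integrableP : iRN.
  - by apply: measurableT_comp => //; exact: measurable_int iRN.
have iu : m.-integrable setT (EFin \o u).
  rewrite (_ : EFin \o u = (fun x => (fine (RN x) * f x)%:E - (c x)%:E)%E)//.
  by apply: integrableB => //; exact: bmfun_integrable.
have Iu : (\int[m]_x (u x)%:E =
    (- ln e - fine (m B) / e + fine (m B))%:E)%E.
  rewrite (_ : (fun x => (u x)%:E) = (fun x => (fine (RN x) * f x)%:E - (c x)%:E)%E)//.
  rewrite integralB//; last exact: bmfun_integrable.
  rewrite ifRN -Rint_EFin//; congr EFin.
  rewrite Rint_D; [|exact: bmfun_cst|by apply: bmfunM => //; exact: bmfun_cst].
  rewrite Rint_Z// Rint_indic//.
  have -> : \int[m]_x (1 : R) = 1 by exact: Rint_cst.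
  by ring.
apply: (@le_trans _ _ (\int[m]_x (u x)%:E)%E).
  by rewrite Iu lee_fin lerDl fine_ge0.
have mv : measurable_fun setT v by apply: (measurableT_comp (@measurable_xlnx R)).
have mu' : measurable_fun setT (EFin \o u) by exact: measurable_int iu.
have mv' : measurable_fun setT (EFin \o v) by exact/measurable_EFinP.
rewrite [leLHS]integralE [leRHS]integralE; apply: leeB.
- apply: ge0_le_integral => //; [exact: measurable_funepos..|].
  move=> x _; apply: (@funepos_le _ _ setT); last exact: in_setT.
  by move=> y _; rewrite lee_fin.
- apply: ge0_le_integral => //; [exact: measurable_funeneg..|].
  move=> x _; apply: (@funeneg_le _ _ setT); last exact: in_setT.
  by move=> y _; rewrite lee_fin.
Qed.

End relative_entropy.

Section displacement_convexity.
Context (R : realType) (X : pointedType) (d : X -> X -> R).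
Hypothesis dP : tb_pseudometric d.

(** Displacement convexity at time 1/2, between [m] conditioned on [A0] and [m]
    conditioned on [A1]: in exponential form, a Brunn-Minkowski inequality for
    the [m]-masses of [A0], [A1] and [B]. *)
Lemma Ric_midpoint_inequality (m : Prob R d) (K kappa e : R) (A0 A1 B : set (borel d)) :
  generalized_Ric_ge d m K ->
  measurable A0 -> measurable A1 -> measurable B ->
  0 < fine (m A0) -> 0 < fine (m A1) -> 0 < kappa -> 0 < e -> e <= 1 ->
  (forall x y z, A0 x -> A1 z -> ~ B y ->
    d x z ^+ 2 + kappa <= 2 * d x y ^+ 2 + 2 * d y z ^+ 2) ->
  - ln e - fine (m B) / e <=
    - ln (fine (m A0)) / 2 - ln (fine (m A1)) / 2 + `|K| / 8.
Proof.
move=> ric mA0 mA1 mB pA0 pA1 kappa0 e0 e1 far.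
pose mu0 := cond_prob mA0 pA0; pose mu1 := cond_prob mA1 pA1.
have [c [_ c0 c1 _ cd] cent] := ric mu0 mu1 (dens_dominates _) (dens_dominates _).
have half01 : 0 <= (2^-1 : R) <= 1 by apply/andP; split; lra.
pose h : {i01 R} := clamp01 2^-1.
have hE : h%:num = 2^-1 :> R by rewrite /h clamp01_val.
have w0 : wasserstein d mu0 (c h) = 2^-1 * wasserstein d mu0 mu1.
  by rewrite -[in LHS]c0 cd hE/= sub0r normrN ger0_norm.
have w1 : wasserstein d (c h) mu1 = 2^-1 * wasserstein d mu0 mu1.
  rewrite -[in LHS]c1 cd hE/=; congr (_ * _).
  by rewrite ler0_norm; lra.
have cB : c h B = 1%E.
  exact: (midpoint_concentration dP mA0 mA1 mB kappa0 far
    (cond_probC mA0 pA0) (cond_probC mA1 pA1) w0 w1).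
have := le_trans (entropy_ge m mB cB e0 e1) (cent h).
rewrite !entropy_cond_prob hE -!EFinM -EFinD lee_fin.
set D := wasserstein d mu0 mu1.
have D0 : 0 <= D by exact: wasserstein_ge0.
have D1 : D <= 1 by exact: wasserstein_le1.
have KD : - (K * D ^+ 2) <= `|K|.
  rewrite -mulNr (le_trans (ler_norm _))// normrM normrN.
  by rewrite ler_piMr// ger0_norm ?sqr_ge0// expr_le1.
move: KD; move: (D ^+ 2) (ln _) (ln _) (ln e) (_ / e) => D2 l0 l1 l q.
move=> KD; lra.
Qed.

End displacement_convexity.

(** * L2 geometry of quantile functions *)

Section L2_geometry.
Context {R : realType}.
Local Notation I := {i01 R}.
Local Notation leb := (@leb01 R).
Implicit Types g h k : G0 R.

Lemma bmfun_num01 : @bmfun _ (borel (@dist01 R)) R (fun x : I => x%:num).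
Proof.
split; first exact: measurable_num01.
by exists 1 => x; rewrite ger0_norm.
Qed.

Lemma bmfun_G0 g : @bmfun _ (borel (@dist01 R)) R (fun s => (g s)%:num).
Proof.
apply: (bmfun_comp _ bmfun_num01).
exact: measurable_monotone01 (@rc_homo R (repr g)).
Qed.

Lemma G0_homo g : {homo g : x y / x <= y}.
Proof. exact: rc_homo. Qed.

Lemma leb01_itv (J : interval R) : [set` J] `<=` `[0, 1]%classic ->
  leb [set s : I | s%:num \in J] = lebesgue_measure [set` J].
Proof.
move=> J01; rewrite /leb01; congr lebesgue_measure.
apply/seteqP; split => [_ [x h <-]//|x Jx]; have /= := J01 _ Jx.
rewrite in_itv/= => x01; exists (clamp01 x); last exact: clamp01_val.
by rewrite /= clamp01_val.
Qed.

Lemma leb01_co (a b : R) : 0 <= a -> a <= b -> b <= 1 ->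
  leb [set s : I | a <= s%:num < b] = (b - a)%:E.
Proof.
move=> a0 ab b1; rewrite (_ : [set _ | _] = [set s : I | s%:num \in `[a, b[]); last first.
  by apply/seteqP; split => s; rewrite /= in_itv.
rewrite leb01_itv => [|x /=].
  by rewrite lebesgue_measure_itv/= lte_fin; case: ltgtP ab => //= ->; rewrite subrr.
by rewrite !in_itv/= => /andP[ax /ltW xb]; rewrite (le_trans a0)//= (le_trans xb).
Qed.

Lemma leb01_cc (a b : R) : 0 <= a -> a <= b -> b <= 1 ->
  leb [set s : I | a <= s%:num <= b] = (b - a)%:E.
Proof.
move=> a0 ab b1; rewrite (_ : [set _ | _] = [set s : I | s%:num \in `[a, b]]); last first.
  by apply/seteqP; split => s; rewrite /= in_itv.
rewrite leb01_itv => [|x /=].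
  by rewrite lebesgue_measure_itv/= lte_fin; case: ltgtP ab => //= ->; rewrite subrr.
by rewrite !in_itv/= => /andP[ax xb]; rewrite (le_trans a0)//= (le_trans xb).
Qed.

Lemma measurable_num01_itv (J : interval R) :
  measurable ([set s : I | s%:num \in J] : set (borel (@dist01 R))).
Proof.
have := @measurable_num01 R measurableT [set` J].
by rewrite setTI; apply; exact: measurable_itv.
Qed.

Lemma measurable_co01 (a b : R) :
  measurable ([set s : I | a <= s%:num < b] : set (borel (@dist01 R))).
Proof.
rewrite (_ : [set _ | _] = [set s : I | s%:num \in `[a, b[]).
  exact: measurable_num01_itv.
by apply/seteqP; split => s; rewrite /= in_itv.
Qed.

Lemma measurable_cc01 (a b : R) :
  measurable ([set s : I | a <= s%:num <= b] : set (borel (@dist01 R))).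
Proof.
rewrite (_ : [set _ | _] = [set s : I | s%:num \in `[a, b]]).
  exact: measurable_num01_itv.
by apply/seteqP; split => s; rewrite /= in_itv.
Qed.

Lemma Rint_ge_co (f : borel (@dist01 R) -> R) (c a b : R) :
  bmfun f -> (forall s, 0 <= f s) -> 0 <= a -> a <= b -> b <= 1 ->
  (forall s : I, a <= s%:num < b -> c <= f s) ->
  c * (b - a) <= \int[leb]_s f s.
Proof.
move=> bf f0 a0 ab b1 fc.
have mE := measurable_co01 a b.
have bi := bmfun_indic R mE.
have -> : c * (b - a) = \int[leb]_s (c * \1_([set s : I | a <= s%:num < b]) s).
  rewrite Rint_Z// Rint_indic//; congr (c * _).
  by rewrite -[LHS]/(fine (b - a)%:E) -leb01_co.
apply: Rint_le => //.
  by apply: bmfunM => //; exact: bmfun_cst.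
move=> s; rewrite indicE; case: (boolP (_ \in _)) => [/set_mem/= /fc|_].
  by rewrite mulr1.
by rewrite mulr0.
Qed.

Lemma dL2_sqr g h : dL2 g h ^+ 2 = \int[leb]_s (((g s)%:num - (h s)%:num) ^+ 2).
Proof.
set J := \int[leb]_s _.
have bf : @bmfun _ (borel (@dist01 R)) R (fun s => ((g s)%:num - (h s)%:num) ^+ 2).
  by apply/bmfunX/bmfunB; exact: bmfun_G0.
have J0 : 0 <= J by apply: Rintegral_ge0 => s _; exact: sqr_ge0.
suff -> : dL2 g h = Num.sqrt J by rewrite sqr_sqrtr.
rewrite /dL2 unlock/=.
rewrite (_ : (\int[_]_x _)%E = J%:E).
  by rewrite poweR_EFin/= powR12_sqrt.
rewrite Rint_EFin//; apply: eq_integral => s _ /=.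
by rewrite powR_mulrn// real_normK// num_real.
Qed.

Lemma dL2_ge0 g h : 0 <= dL2 g h.
Proof. by rewrite fine_ge0// Lnorm_ge0. Qed.

Lemma num01_dist_le1 (x y : I) : `|x%:num - y%:num| <= 1.
Proof.
have x0 : 0 <= x%:num by []. have x1 : x%:num <= 1 by [].
have y0 : 0 <= y%:num by []. have y1 : y%:num <= 1 by [].
by rewrite ler_norml; lra.
Qed.

Lemma dL2_le1 g h : dL2 g h <= 1.
Proof.
rewrite -(ler_pXn2r (n := 2))// ?nnegrE ?dL2_ge0// expr1n dL2_sqr.
have <- : \int[leb]_s (1 : R) = 1 by exact: Rint_cst.
apply: Rint_le.
- by apply/bmfunX/bmfunB; exact: bmfun_G0.
- exact: bmfun_cst.
- move=> s; rewrite -real_normK ?num_real// -(expr1n _ 2).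
  by rewrite ler_pXn2r ?nnegrE// num01_dist_le1.
Qed.

Lemma dL2C g h : dL2 g h = dL2 h g.
Proof.
apply/eqP; rewrite -(eqrXn2 (n := 2))// ?dL2_ge0//; apply/eqP.
by rewrite !dL2_sqr; apply: eq_Rintegral => s _; ring.
Qed.

Lemma dL2xx g : dL2 g g = 0.
Proof.
apply/eqP; rewrite -(eqrXn2 (n := 2))// ?dL2_ge0// dL2_sqr expr0n; apply/eqP.
under eq_Rintegral do rewrite subrr expr0n.
by exact: Rint_cst.
Qed.

Lemma dL2_triangle g h k : dL2 g k <= dL2 g h + dL2 h k.
Proof.
have bf (a b : G0 R) := bmfunB (bmfun_G0 a) (bmfun_G0 b).
have fin (a b : G0 R) :
    Lnorm leb 2%:E (fun s => ((a s)%:num - (b s)%:num)%:E) \is a fin_num.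
  rewrite unlock/=.
  rewrite (_ : (\int[_]_x _)%E = (dL2 a b ^+2)%:E); first by rewrite poweR_EFin.
  rewrite dL2_sqr Rint_EFin; last exact/bmfunX.
  apply: eq_integral => s _ /=.
  by rewrite powR_mulrn// real_normK// num_real.
rewrite /dL2 -fineD// fine_le ?fin_numD ?fin//.
apply: le_trans (minkowski_EFin leb _ _ (_ : 1 <= 2%R)).
- rewrite le_eqVlt; apply/orP; left; apply/eqP; congr Lnorm.
  by apply/funext => s /=; congr EFin; ring.
- exact: (bf g h).1.
- exact: (bf h k).1.
- by lra.
Qed.

Lemma dL2_parallelogram g h k :
  dL2 g h ^+ 2 + \int[leb]_s ((2 * (k s)%:num - (g s)%:num - (h s)%:num) ^+ 2) =
  2 * dL2 g k ^+ 2 + 2 * dL2 k h ^+ 2.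
Proof.
have bf (a b : G0 R) := bmfunX 2 (bmfunB (bmfun_G0 a) (bmfun_G0 b)).
have bk : @bmfun _ (borel (@dist01 R)) R
    (fun s => (2 * (k s)%:num - (g s)%:num - (h s)%:num) ^+ 2).
  apply/bmfunX/bmfunB; last exact: bmfun_G0.
  apply: bmfunB; last exact: bmfun_G0.
  by apply: bmfunM; [exact: bmfun_cst|exact: bmfun_G0].
rewrite !dL2_sqr -Rint_D//.
rewrite -!Rint_Z; [|exact: bf..].
rewrite -Rint_D; last 2 first.
- by apply: bmfunM; [exact: bmfun_cst|exact: bf].
- by apply: bmfunM; [exact: bmfun_cst|exact: bf].
by apply: eq_Rintegral => s _; ring.
Qed.

(** By right continuity [g] stays below [c], with a margin, on an interval to
    the right of [t]; a monotone [h] with h(t) >= c is above [c] on all of it,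
    which forces a definite L2 distance. *)
Lemma dL2_lt_open (t : I) (c : R) g : t%:num < 1 -> (g t)%:num < c ->
  exists2 e : R, 0 < e & forall h, dL2 g h < e -> (h t)%:num < c.
Proof.
move=> t1 gc; pose dlt := (c - (g t)%:num) / 2.
have dlt0 : 0 < dlt by rewrite /dlt; lra.
have [r r0 gr] := rc_right_cont (repr g) t dlt0.
have t0 : 0 <= t%:num by [].
pose b := Num.min (t%:num + r) 1.
have tb : t%:num < b by rewrite /b lt_min t1 andbT ltrDl.
have b1 : b <= 1 by rewrite /b ge_min lexx orbT.
have btr : b <= t%:num + r by rewrite /b ge_min lexx.
exists (Num.sqrt (dlt ^+ 2 * (b - t%:num))).
  by rewrite sqrtr_gt0 mulr_gt0// ?exprn_gt0// subr_gt0.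
move=> h; apply: contraTT; rewrite -!leNgt => ch.
rewrite -[leRHS]ger0_norm ?dL2_ge0// -sqrtr_sqr ler_wsqrtr// dL2_sqr.
apply: Rint_ge_co => //; last 2 first.
- exact: ltW.
- move=> s /andP[ts sb].
  have := gr s ts (lt_le_trans sb btr); rewrite ltr_norml => /andP[_ gs].
  have hs : (h t)%:num <= (h s)%:num by exact: G0_homo.
  rewrite -[leRHS]sqrrN opprB ler_pXn2r ?nnegrE ?(ltW dlt0)//.
    by move: gs ch hs; rewrite /dlt /right_cont_repr; lra.
  by move: gs ch hs; rewrite /dlt /right_cont_repr; lra.
- by apply/bmfunX/bmfunB; exact: bmfun_G0.
- by move=> s; exact: sqr_ge0.
Qed.

End L2_geometry.

(** * The monotone coupling is optimal *)

Lemma count_below (R : realType) n (y : R) : 0 <= y ->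
  Num.min y n%:R <= \sum_(k < n) (k%:R < y)%R%:R :> R /\
  \sum_(k < n) (k%:R < y)%R%:R <= Num.min n%:R (y + 1) :> R.
Proof.
move=> y0; elim: n => [|n [IH1 IH2]].
  rewrite big_ord0 ge_min lexx orbT; split => //.
  by rewrite le_min lexx/=; lra.
rewrite big_ord_recr/=; move: IH1 IH2.
rewrite ge_min !le_min ge_min -natr1 => IH1 /andP[IH2 IH3].
have [ny|yn] := ltP; rewrite /=.
  have {}IH1 : n%:R <= \sum_(i < n) (i%:R < y)%R%:R :> R.
    by case/orP : IH1 => //; apply: le_trans; exact: ltW.
  split; first by apply/orP; right; lra.
  by apply/andP; split; lra.
have {}IH1 : y <= \sum_(i < n) (i%:R < y)%R%:R :> R.
  by case/orP : IH1 => // h; apply: le_trans h.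
split; first by apply/orP; left; lra.
by apply/andP; split; lra.
Qed.

Section monotone_coupling.
Context {R : realType}.
Local Notation I := {i01 R}.
Local Notation d01 := (@dist01 R).
Local Notation leb := (@leb01 R).
Variables g h : G0 R.

Lemma measurable_G0 (k : G0 R) :
  measurable_fun setT (k : borel d01 -> borel d01).
Proof. exact: measurable_monotone01 (@rc_homo R (repr k)). Qed.

Lemma Rint_Psi (f : borel d01 -> R) (k : G0 R) : bmfun f ->
  \int[Psi k]_x f x = \int[leb]_s f (k s).
Proof.
move=> bf; transitivity (\int[law leb (measurable_G0 k)]_x f x); last first.
  by rewrite Rint_law.
by congr fine; apply: eq_measure_integral.
Qed.

Variable pi : Prob R (dist_prod d01).
Hypothesis cpi : coupling (Psi g) (Psi h) pi.

Definition upper (c : R) : set (borel d01) := [set x : I | c < x%:num].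

Lemma measurable_upper c : measurable (upper c).
Proof.
rewrite (_ : upper c = [set x : I | x%:num \in `]c, +oo[]).
  exact: measurable_num01_itv.
by apply/seteqP; split => x; rewrite /upper/= in_itv/= andbT.
Qed.

Lemma bmfun_fst01 (f : borel d01 -> R) : bmfun f ->
  @bmfun _ (borel (dist_prod d01)) R (fun z => f z.1).
Proof. exact: bmfun_comp (measurable_fst_dist_prod (d := d01)). Qed.

Lemma bmfun_snd01 (f : borel d01 -> R) : bmfun f ->
  @bmfun _ (borel (dist_prod d01)) R (fun z => f z.2).
Proof. exact: bmfun_comp (measurable_snd_dist_prod (d := d01)). Qed.

Lemma bmfun_pull (f : borel d01 -> R) (k : G0 R) : bmfun f ->
  @bmfun _ (borel d01) R (fun s => f (k s)).
Proof. exact: bmfun_comp (measurable_G0 k). Qed.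

(** By monotonicity one of the events g > a and h > b contains the other, so
    their joint probability under Lebesgue measure is the smaller of the two
    marginal probabilities, which no coupling can exceed. *)
Lemma Rint_upper_coupling a b :
  \int[pi]_z (\1_(upper a) z.1 * \1_(upper b) z.2) <=
  \int[leb]_s (\1_(upper a) (g s) * \1_(upper b) (h s)).
Proof.
have bu c : bmfun (\1_(upper c) : borel d01 -> R).
  by apply: bmfun_indic; exact: measurable_upper.
have b1 c := bmfun_fst01 (bu c).
have b2 c := bmfun_snd01 (bu c).
have b3 c k := bmfun_pull k (bu c).
have [gh|gh] := pselect (forall s : I, a < (g s)%:num -> b < (h s)%:num).
  rewrite [leRHS](_ : _ = \int[pi]_z (\1_(upper a) z.1)).
    apply: Rint_le => //; first exact: bmfunM.
    by move=> z; rewrite !indicE; do 2 case: (_ \in _); rewrite ?(mulr0, mulr1, mul0r).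
  rewrite (Rint_coupling_fst cpi)// Rint_Psi//; apply: eq_Rintegral => s _.
  rewrite !indicE; case: (boolP (_ \in _)) => [/set_mem/gh hb|_]; rewrite ?mul0r//.
  by rewrite mem_set// mulr1.
have {}gh : forall s : I, b < (h s)%:num -> a < (g s)%:num.
  move=> s hs; rewrite ltNge; apply/negP => gs; apply: gh => s' gs'.
  apply: lt_le_trans hs _; have [ss'|s's] := leP s s'; first exact: (G0_homo h ss').
  have gss : (g s')%:num <= (g s)%:num by exact: (G0_homo g (ltW s's)).
  by have := lt_le_trans gs' (le_trans gss gs); rewrite ltxx.
rewrite [leRHS](_ : _ = \int[pi]_z (\1_(upper b) z.2)).
  apply: Rint_le => //; first exact: bmfunM.
  by move=> z; rewrite !indicE; do 2 case: (_ \in _); rewrite ?(mulr0, mulr1, mul0r).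
rewrite (Rint_coupling_snd cpi)// Rint_Psi//; apply: eq_Rintegral => s _.
rewrite !indicE mulrC; case: (boolP (_ \in upper b)) => [/set_mem/gh hb|_]; rewrite ?mul0r//.
by rewrite mem_set// mulr1.
Qed.

(** A discrete layer-cake formula: the average of the indicators of x > k / n'
    for k < n', where n' = n + 1, is x rounded up to a multiple of 1 / n'. *)
Definition stair n (x : borel d01) : R :=
  n.+1%:R^-1 * \sum_(k < n.+1) \1_(upper (k%:R / n.+1%:R)) x.

Lemma bmfun_stair n : bmfun (stair n).
Proof.
apply: bmfunM; first exact: bmfun_cst.
by apply: bmfun_sum => k; apply: bmfun_indic; exact: measurable_upper.
Qed.

Lemma stair_bounds n (x : I) :
  [/\ x%:num <= stair n x, stair n x <= x%:num + n.+1%:R^-1 & stair n x <= 1].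
Proof.
have n0 : 0 < n.+1%:R :> R by [].
have x0 : 0 <= x%:num by []. have x1 : x%:num <= 1 by [].
have [] := @count_below R n.+1 (n.+1%:R * x%:num); first exact: mulr_ge0.
have -> : \sum_(k < n.+1) (k%:R < n.+1%:R * x%:num)%R%:R = n.+1%:R * stair n x.
  rewrite /stair mulVKf ?gt_eqF//; apply: eq_bigr => k _.
  rewrite indicE; congr (nat_of_bool _)%:R.
  by apply/idP/idP => [kx|/set_mem]; [apply/mem_set|];
    rewrite /upper/= ltr_pdivrMr// mulrC.
rewrite min_l; last by rewrite ler_piMr// ltW.
rewrite le_min => h1 /andP[h2 h3]; split.
- by rewrite -(ler_pM2l n0).
- by rewrite -(ler_pM2l n0) mulrDr divff ?gt_eqF.
- by rewrite -(ler_pM2l n0) mulr1.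
Qed.

(** The two squares in the expansion depend on the marginals only; the cross
    term is a positive combination of the integrals of [Rint_upper_coupling]. *)
Lemma Rint_stair_coupling n :
  \int[leb]_s ((stair n (g s) - stair n (h s)) ^+ 2) <=
  \int[pi]_z ((stair n z.1 - stair n z.2) ^+ 2).
Proof.
have bu c : bmfun (\1_(upper c) : borel d01 -> R).
  by apply: bmfun_indic; exact: measurable_upper.
have bs := bmfun_stair n.
have b1 := bmfun_fst01 bs. have b2 := bmfun_snd01 bs.
have bg := bmfun_pull g bs. have bh := bmfun_pull h bs.
have expand d (T : measurableType d) (Q : probability T R) (u v : T -> R) :
    bmfun u -> bmfun v -> \int[Q]_x ((u x - v x) ^+ 2) =
    \int[Q]_x (u x ^+ 2) + \int[Q]_x (v x ^+ 2) - 2 * \int[Q]_x (u x * v x).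
  move=> bu' bv'.
  rewrite -Rint_D; [|exact: bmfunX..].
  rewrite -Rint_Z; last exact: bmfunM.
  rewrite -Rint_B.
  - by apply: eq_Rintegral => x _; ring.
  - by apply: bmfunD; exact: bmfunX.
  - by apply: bmfunM; [exact: bmfun_cst|exact: bmfunM].
rewrite !expand//.
have bs2 : bmfun (fun x => stair n x ^+ 2) by exact: bmfunX.
rewrite (Rint_coupling_fst cpi bs2) (Rint_coupling_snd cpi bs2) !Rint_Psi//.
rewrite lerB// ler_pM2l//.
pose q : R := n.+1%:R^-1 ^+ 2.
pose c (k : 'I_n.+1) : R := k%:R / n.+1%:R.
have prodE x y : stair n x * stair n y =
    q * \sum_j \sum_k (\1_(upper (c j)) x * \1_(upper (c k)) y).
  rewrite /stair /q mulrACA expr2; congr (_ * _); rewrite mulr_suml.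
  by apply: eq_bigr => j _; rewrite mulr_sumr.
under eq_Rintegral do rewrite prodE.
under [leRHS]eq_Rintegral do rewrite prodE.
have bb1 (j k : 'I_n.+1) : @bmfun _ (borel (dist_prod d01)) R
    (fun z => \1_(upper (c j)) z.1 * \1_(upper (c k)) z.2).
  by apply: bmfunM; [exact: bmfun_fst01|exact: bmfun_snd01].
have bb2 (j k : 'I_n.+1) : @bmfun _ (borel d01) R
    (fun s => \1_(upper (c j)) (g s) * \1_(upper (c k)) (h s)).
  by apply: bmfunM; exact: bmfun_pull.
rewrite !Rint_Z; [|by apply: bmfun_sum => j; apply: bmfun_sum => k..].
rewrite ler_wpM2l ?sqr_ge0//.
rewrite !Rint_sum; [|by move=> j; apply: bmfun_sum => k..].
apply: ler_sum => j _; rewrite !Rint_sum//; apply: ler_sum => k _.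
exact: Rint_upper_coupling.
Qed.

Lemma dL2_le_cost : dL2 g h ^+ 2 <= \int[pi]_z (d01 z.1 z.2 ^+ 2).
Proof.
apply/ler_addgt0Pr => e e0.
have [n ne] : exists n : nat, n.+1%:R^-1 < e / 4 by apply: inv_nat_lt; lra.
have bs := bmfun_stair n.
have err (x y : I) : `|(stair n x - stair n y) ^+ 2 - (x%:num - y%:num) ^+ 2| <= e / 2.
  have [] := stair_bounds n x; have [] := stair_bounds n y.
  have : 0 <= x%:num by []. have : x%:num <= 1 by [].
  have : 0 <= y%:num by []. have : y%:num <= 1 by [].
  move: (stair n x) (stair n y) x%:num y%:num (n.+1%:R^-1) ne => a b x' y' q *.
  rewrite subr_sqr normrM.
  have h1 : `|a - b - (x' - y')| <= q by rewrite ler_norml; apply/andP; split; lra.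
  have h2 : `|a - b + (x' - y')| <= 2 by rewrite ler_norml; apply/andP; split; lra.
  apply: (le_trans (ler_pM _ _ h1 h2)) => //; lra.
have bpi : @bmfun _ (borel (dist_prod d01)) R (fun z => d01 z.1 z.2 ^+ 2).
  apply: bmfunX; split; first exact: measurable_dist01_prod.
  by exists 1 => z; rewrite normr_id num01_dist_le1.
have bst : @bmfun _ (borel (dist_prod d01)) R (fun z => (stair n z.1 - stair n z.2) ^+ 2).
  by apply/bmfunX/bmfunB; [exact: bmfun_fst01|exact: bmfun_snd01].
have bgh : @bmfun _ (borel d01) R (fun s => (stair n (g s) - stair n (h s)) ^+ 2).
  by apply/bmfunX/bmfunB; exact: bmfun_pull.
have h1 : dL2 g h ^+ 2 <= \int[leb]_s ((stair n (g s) - stair n (h s)) ^+ 2) + e / 2.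
  rewrite dL2_sqr -[X in _ + X](Rint_cst leb) -Rint_D//; last exact: bmfun_cst.
  apply: Rint_le; [by apply/bmfunX/bmfunB; exact: bmfun_G0| |].
    by apply: bmfunD => //; exact: bmfun_cst.
  by move=> s; have := err (g s) (h s); rewrite ler_norml => /andP[]; lra.
have h2 : \int[pi]_z ((stair n z.1 - stair n z.2) ^+ 2) <=
    \int[pi]_z (d01 z.1 z.2 ^+ 2) + e / 2.
  rewrite -[X in _ + X](Rint_cst pi) -Rint_D//; last exact: bmfun_cst.
  apply: Rint_le => //; first by apply: bmfunD => //; exact: bmfun_cst.
  move=> z; have := err z.1 z.2; rewrite ler_norml => /andP[_].
  by rewrite /dist01 real_normK ?num_real//; lra.
apply: (le_trans h1); rewrite [in leRHS](splitr e) addrA lerD2r.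
exact: le_trans (Rint_stair_coupling n) h2.
Qed.

End monotone_coupling.

Section isometry.
Context {R : realType}.
Local Notation I := {i01 R}.
Local Notation d01 := (@dist01 R).

Lemma dist01_tb : tb_pseudometric d01.
Proof.
split=> [x y|x y|x y z|x y|e e0].
- exact: normr_ge0.
- by rewrite /dist01 distrC.
- by rewrite /dist01 (le_trans _ (ler_normD _ _))// subrKA.
- exact: num01_dist_le1.
- have [n ne] := inv_nat_lt e0; have n0 : 0 < n.+1%:R :> R by [].
  exists [seq clamp01 (i%:R / n.+1%:R) | i <- iota 0 n.+2] => x.
  have x0 : 0 <= x%:num by []. have x1 : x%:num <= 1 by [].
  pose k := Num.truncn (n.+1%:R * x%:num).
  have /andP[k1 k2] := truncn_itv (mulr_ge0 (ltW n0) x0).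
  have kn : (k < n.+2)%N.
    rewrite ltnS -(ler_nat R); apply: le_trans k1 _.
    by rewrite ler_piMr// ltW.
  exists (clamp01 (k%:R / n.+1%:R)).
    by apply/mapP; exists k => //; rewrite mem_iota.
  rewrite /dist01 clamp01_val; last first.
    by rewrite divr_ge0//= ler_pdivrMr// mul1r ler_nat.
  apply: le_lt_trans ne; rewrite -(ler_pM2l n0) divff ?gt_eqF//.
  rewrite -[X in X * _]gtr0_norm// -normrM mulrBr mulrCA divff ?gt_eqF// mulr1.
  move: k1 k2; rewrite -/k -natr1 ler_norml => k1 k2.
  by apply/andP; split; lra.
Qed.

(** Hoeffding's argument: after rounding, the cost of any coupling is at least
    that of the monotone one, and the rounding error is arbitrarily small. *)
Lemma wasserstein_Psi (g h : G0 R) : wasserstein d01 (Psi g) (Psi h) = dL2 g h.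
Proof.
apply/eqP; rewrite eq_le wasserstein_Psi_le/=.
rewrite -(ler_pXn2r (n := 2))// ?nnegrE ?dL2_ge0 ?wasserstein_ge0//.
apply/ler_addgt0Pr => e e0.
have [pi cpi hpi] := wasserstein_near_optimal dist01_tb (Psi g) (Psi h) e0.
by apply: le_trans (ltW hpi); exact: dL2_le_cost.
Qed.

End isometry.

(** * Every probability measure on the unit interval has a quantile function *)

Section probabilities_on_01.
Context {R : realType}.
Local Notation I := {i01 R}.
Local Notation d01 := (@dist01 R).
Local Notation leb := (@leb01 R).

Definition below (c : R) : set (borel d01) := [set x : I | x%:num <= c].

Lemma below_upper c : below c = ~` upper c.
Proof.
by apply/seteqP; split => x; rewrite /below /upper/= leNgt => /negP.
Qed.

Lemma measurable_below c : measurable (below c).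
Proof. by rewrite below_upper; apply: measurableC; exact: measurable_upper. Qed.

Lemma prob01_unique (mu nu : Prob R d01) :
  (forall c, mu (below c) = nu (below c)) ->
  forall A, measurable A -> mu A = nu A.
Proof.
move=> h A mA.
have eq_upper c : mu (upper c) = nu (upper c).
  have := h c; rewrite below_upper !probability_setC; [|exact: measurable_upper..].
  have := fin_num_measure mu (upper c) (measurable_upper c).
  have := fin_num_measure nu (upper c) (measurable_upper c).
  case: (mu (upper c)) => // x; case: (nu (upper c)) => // y _ _.
  by rewrite -!EFinB => -[xy]; congr EFin; lra.
have pre (k : R) : (fun x : I => x%:num) @^-1` `]k, +oo[ = upper k.
  by apply/seteqP; split => x; rewrite /upper/= in_itv/= andbT.
pose num := @measurable_num01 R.
have := @measure_unique _ _ (measurableTypeR R) (@RGenOInfty.G R)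
  (fun k : nat => `](- k%:R), +oo[%classic) (RGenOInfty.measurableE R) _ _ _
  (law mu num) (law nu num).
have -> : A = (fun x : I => x%:num) @^-1` (clamp01 @^-1` A).
  by apply/seteqP; split => x; rewrite /= clamp01K.
rewrite -(lawE mu num) -(lawE nu num); apply.
- move=> _ _ [x ->] [y ->]; exists (Num.max x y).
  by apply/seteqP; split => z /=; rewrite !in_itv/= !andbT gt_max => /andP.
- by move=> i; exists (- i%:R).
- apply/seteqP; split => // x _; exists `|Num.floor x|%N.+1 => //=.
  rewrite in_itv/= andbT ltrNl (le_lt_trans (ler_norm _))//.
  rewrite normrN -natr1.
  have := floor_le x; have := floorD1_gt x; rewrite intrD.
  have : `|(Num.floor x)%:~R| = `|Num.floor x|%N%:R :> R.
    by rewrite natr_absz intr_norm.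
  move=> <-; rewrite ltr_norml; move: (Num.floor x)%:~R => f fx xf.
  have := ler_norm f; have := ler_norm (- f); rewrite normrN.
  by move=> ? ?; apply/andP; split; lra.
- move=> _ [x ->]; rewrite -[LHS]/(mu (_ @^-1` _)) -[RHS]/(nu (_ @^-1` _)) pre.
  exact: eq_upper.
- move=> k; rewrite -[X in (X < _)%E]/(mu (_ @^-1` _)) pre.
  by rewrite (le_lt_trans (probability_le1 _ _)) ?ltry//; exact: measurable_upper.
- rewrite -[X in measurable X]setTI; exact: measurable_clamp01.
Qed.

Variable mu : Prob R d01.

Let F (c : R) : R := fine (mu (below c)).

Let F_nd x y : x <= y -> F x <= F y.
Proof.
move=> xy; rewrite fine_le ?fin_num_measure//; [exact: measurable_below..|].
apply: le_measure; rewrite ?inE; [exact: measurable_below..|].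
by move=> z; rewrite /below/= => /le_trans; apply.
Qed.

Let F_le1 c : F c <= 1.
Proof.
have mb := measurable_below c.
by rewrite -lee_fin fineK ?fin_num_measure// probability_le1.
Qed.

Let F_ge0 c : 0 <= F c.
Proof. exact: fine_ge0. Qed.

(* The infimum of [S s] is the right-continuous inverse of the distribution
   function [F] at s. Including 1 keeps [S s] inhabited also at s = 1. *)
Let S (s : R) : set R := [set c | 0 <= c <= 1 /\ (s < F c \/ c = 1)].

Let S1 s : S s 1.
Proof. by split; [rewrite ler01 lexx|right]. Qed.

Let S_lb s : lbound (S s) 0.
Proof. by move=> x [/andP[]]. Qed.

Let inf01 s : 0 <= inf (S s) <= 1.
Proof.
apply/andP; split; first by apply: lb_le_inf => //; exists 1.
by apply: ge_inf => //; exists 0.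
Qed.

Let q (s : I) : I := clamp01 (inf (S s%:num)).

Let qE s : (q s)%:num = inf (S s%:num).
Proof. exact: clamp01_val. Qed.

Let q_le (s : I) c : S s%:num c -> (q s)%:num <= c.
Proof. by move=> Sc; rewrite qE; apply: ge_inf => //; exists 0. Qed.

Let q_lt (s : I) c : (q s)%:num < c -> exists2 x, S s%:num x & x < c.
Proof. by rewrite qE => /inf_lt; apply; exists 1. Qed.

Let q_homo : {homo q : x y / x <= y}.
Proof.
move=> x y xy; change ((q x)%:num <= (q y)%:num).
rewrite [leRHS]qE; apply: lb_le_inf; first by exists 1.
move=> c [c01 [yc|c1]]; apply: q_le; split => //; [left|by right].
by apply: le_lt_trans yc.
Qed.

Let q_rc s (e : R) : 0 < e -> exists2 r : R, 0 < r &
    forall t, s <= t -> t%:num < s%:num + r -> `|(q t)%:num - (q s)%:num| < e.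
Proof.
move=> e0.
have [|c [c01 hc] cq] := @q_lt s ((q s)%:num + e); first by rewrite ltrDl.
have [r r0 hr] : exists2 r, 0 < r &
    forall t : I, t%:num < s%:num + r -> (q t)%:num <= c.
  case: hc => [sc|c1]; last first.
    by exists 1 => // t _; apply: q_le; split => //; right.
  exists (F c - s%:num); first by rewrite subr_gt0.
  by move=> t tc; apply: q_le; split => //; left; lra.
exists r => // t st tr; have := hr t tr; have : (q s)%:num <= (q t)%:num by exact: q_homo.
by move=> ? ?; rewrite ger0_norm; lra.
Qed.

Let Q : rc_mono R := RcMono q_homo q_rc.

Let measurable_q : measurable_fun setT (q : borel d01 -> borel d01).
Proof. exact: measurable_monotone01. Qed.

(* q(s) <= c holds when s < F(c), and q(s) < c' implies s < F(c'). The gap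
   between the two is closed by letting c' decrease to c. *)
Let law_q c : law leb measurable_q (below c) = mu (below c).
Proof.
have mb := @measurable_below.
rewrite -[RHS]fineK ?fin_num_measure// -/(F c).
rewrite -[LHS]fineK ?fin_num_measure//; congr EFin.
set L := fine _.
have LE : L = fine (leb [set s : I | (q s)%:num <= c]) by [].
have mq c' : measurable ([set s : I | (q s)%:num <= c'] : set (borel d01)).
  by have := measurable_q measurableT (mb c'); rewrite setTI.
have mlt c' : measurable ([set s : I | (q s)%:num < c'] : set (borel d01)).
  rewrite (_ : [set _ | _] = setT `&` q @^-1` [set x : I | x%:num < c']); last first.
    by rewrite setTI.
  apply: measurable_q => //.
  rewrite (_ : mkset _ = [set x : I | x%:num \in `]-oo, c'[]).
    exact: measurable_num01_itv.
  by apply/seteqP; split => x; rewrite /= in_itv.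
have leb_co a : 0 <= a <= 1 -> leb [set s : I | 0 <= s%:num < a] = a%:E.
  by case/andP => a0 a1; rewrite leb01_co// subr0.
have LE' : L%:E = leb [set s : I | (q s)%:num <= c].
  by rewrite LE fineK// fin_num_measure//; exact: mq.
apply/eqP; rewrite eq_le; apply/andP; split; last first.
  have [c0|c0] := ltP c 0.
    have b0 : below c = set0.
      apply/seteqP; split => x //; rewrite /below/= => xc.
      have x0 : 0 <= x%:num by [].
      by have := lt_le_trans (le_lt_trans xc c0) x0; rewrite ltxx.
    by rewrite /F b0 measure0 fine_ge0.
  have [c1|c1] := ltP 1 c.
    have bT : [set s : I | (q s)%:num <= c] = setT.
      by apply/seteqP; split => x // _ /=; exact: le_trans (le1 (q x)) (ltW c1).
    by rewrite LE bT probability_setT F_le1.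
  have F01 : 0 <= F c <= 1 by rewrite F_ge0 F_le1.
  rewrite -lee_fin LE' -(leb_co (F c))//.
  apply: le_measure; rewrite ?inE//; first exact: measurable_co01.
  by move=> s /= /andP[_ sc]; apply: q_le; split; [rewrite c0|left].
have Lle n : (L%:E <= mu (below (c + n.+1%:R^-1)))%E.
  have n0 : 0 < n.+1%:R^-1 :> R by [].
  have [c1|c1] := ltP 1 (c + n.+1%:R^-1).
    have bT : below (c + n.+1%:R^-1) = setT.
      by apply/seteqP; split => x // _; rewrite /below/= (le_trans (le1 x))// ltW.
    rewrite bT probability_setT.
    by rewrite LE' probability_le1.
  apply: (@le_trans _ _ (leb [set s : I | 0 <= s%:num < F (c + n.+1%:R^-1)])).
    rewrite LE'.
    apply: le_measure; rewrite ?inE//; first exact: measurable_co01.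
    move=> s /= sc; have [|x [x01 hx] xc] := @q_lt s (c + n.+1%:R^-1).
      by apply: le_lt_trans sc _; rewrite ltrDl.
    rewrite ge0/=; case: hx => [hx|x1]; last by have := lt_le_trans xc c1; rewrite x1 ltxx.
    by apply: lt_le_trans hx _; apply: F_nd; exact: ltW.
  rewrite leb_co ?F_ge0 ?F_le1// fineK// fin_num_measure//.
have FE : (F c)%:E = mu (below c) by rewrite /F fineK// fin_num_measure.
rewrite -lee_fin FE.
have cap : \bigcap_n below (c + n.+1%:R^-1) = below c.
  apply/seteqP; split => x h; last first.
    by move=> n _; rewrite /below/= (le_trans h)// lerDl.
  apply/ler_addgt0Pr => e /inv_nat_lt[n ne].
  by have /= hn := h n Logic.I; rewrite (le_trans hn)// lerD2l ltW.
have : mu \o (fun n => below (c + n.+1%:R^-1)) @ \oo --> mu (below c).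
  rewrite -[X in _ --> mu X]cap; apply: nonincreasing_cvg_mu => //.
  - by rewrite (le_lt_trans (probability_le1 _ _)) ?ltry.
  - exact: bigcapT_measurable.
  - apply/nonincreasing_seqP => n; apply/subsetPset => x; rewrite /below/= => h.
    by apply: le_trans h _; rewrite lerD2l lef_pV2 ?posrE// ler_nat.
by move=> cv; apply: (cvge_ge _ cv); apply: nearW => n; exact: Lle.
Qed.

Theorem Psi_surjective : exists g : G0 R, forall A, measurable A -> Psi g A = mu A.
Proof.
pose g : G0 R := (\pi_(G0 R) Q)%qT.
have aeQ : {ae leb, forall s, g s = q s}.
  apply/asboolP; change (rc_ae_eq (repr g) Q).
  by have /eqmodP := reprK g.
exists g; apply: prob01_unique => c.
rewrite -law_q.
have mbc := measurable_below c.
rewrite -[LHS]fineK ?fin_num_measure// -[RHS]fineK ?fin_num_measure//.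
have bb := bmfun_indic R mbc.
have e1 : fine (Psi g (below c)) = \int[leb]_s \1_(below c) (g s).
  by rewrite -(Rint_Psi g bb) Rint_indic.
have e2 : fine (law leb measurable_q (below c)) = \int[leb]_s \1_(below c) (q s).
  by rewrite -(Rint_law leb measurable_q bb) Rint_indic.
congr EFin; rewrite e1 e2.
congr fine; apply: ae_eq_integral => //.
- by apply/measurable_EFinP; exact: (bmfun_pull _ (bmfun_indic R mbc)).1.
- by apply/measurable_EFinP; exact: (bmfun_comp measurable_q (bmfun_indic R mbc)).1.
- by apply: (@filterS _ _ (ae_filter_ringOfSetsType leb) _ _ _ aeQ) => s e _;
    rewrite /= e.
Qed.

End probabilities_on_01.

(** * Total boundedness of the Wasserstein space over the unit interval *)

Section net_G0.
Context {R : realType}.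
Local Notation I := {i01 R}.
Local Notation d01 := (@dist01 R).
Local Notation leb := (@leb01 R).

Section fixed_mesh.
Variable N : nat.
Hypothesis N0 : (0 < N)%N.

Let pt (k : nat) : I := clamp01 (k%:R / N%:R).

Let ptE k : (k <= N)%N -> (pt k)%:num = k%:R / N%:R.
Proof.
move=> kN; rewrite clamp01_val//.
by rewrite divr_ge0//= ler_pdivrMr ?ltr0n// mul1r ler_nat.
Qed.

(** The values on a mesh of width 1 / N, rounded down to multiples of 1 / N. *)
Definition mesh_code (g : G0 R) : {ffun 'I_N.+1 -> 'I_N.+1} :=
  [ffun k : 'I_N.+1 => inord (Num.truncn (N%:R * (g (pt k))%:num))].

Let code_close g h k : mesh_code g = mesh_code h -> (k <= N)%N ->
  `|(g (pt k))%:num - (h (pt k))%:num| <= N%:R^-1.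
Proof.
move=> gh kN; have N0' : 0 < N%:R :> R by rewrite ltr0n.
have tb (f : G0 R) : [/\ (Num.truncn (N%:R * (f (pt k))%:num) <= N)%N,
    (Num.truncn (N%:R * (f (pt k))%:num))%:R <= N%:R * (f (pt k))%:num
  & N%:R * (f (pt k))%:num < (Num.truncn (N%:R * (f (pt k))%:num))%:R + 1].
  have f0 : 0 <= (f (pt k))%:num by []. have f1 : (f (pt k))%:num <= 1 by [].
  have /andP[k1 k2] := truncn_itv (mulr_ge0 (ltW N0') f0).
  split => //; last by rewrite natr1.
  by rewrite -(ler_nat R); apply: le_trans k1 _; rewrite ler_piMr// ltW.
have /ffunP/(_ (Ordinal (kN : (k < N.+1)%N))) := gh; rewrite !ffunE/=.
have [g1 g2 g3] := tb g; have [h1 h2 h3] := tb h.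
move=> /(congr1 val)/=; rewrite !inordK// => e.
rewrite -(ler_pM2l N0') divff ?gt_eqF// -[X in X * _]gtr0_norm// -normrM mulrBr.
rewrite e in g2 g3; rewrite ler_norml.
move: g2 g3 h2 h3; move: (N%:R * (g _)%:num) (N%:R * (h _)%:num) (_%:R) => a b c *.
by apply/andP; split; lra.
Qed.

(** On each interval of the mesh the two monotone functions differ by at most
    the increment of [g] plus the rounding error, and the increments telescope
    to at most 1. Since the values lie in [0, 1], the square of the difference
    is at most the difference itself. *)
Lemma mesh_code_dL2 g h : mesh_code g = mesh_code h -> dL2 g h ^+ 2 <= 2 / N%:R.
Proof.
move=> gh; have N0' : 0 < N%:R :> R by rewrite ltr0n.
pose D k : R := (g (pt k.+1))%:num - (g (pt k))%:num + N%:R^-1.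
pose cell k : set (borel d01) := [set s : I | (pt k)%:num <= s%:num <= (pt k.+1)%:num].
have mcell k : measurable (cell k) by exact: measurable_cc01.
have ptS k : pt k <= pt k.+1 by apply: le_clamp01; rewrite ler_pM2r ?invr_gt0// ler_nat.
have D0 k : 0 <= D k.
  apply: addr_ge0; last by rewrite invr_ge0 ltW.
  by rewrite subr_ge0; exact: (G0_homo g (ptS k)).
have bcell k : @bmfun _ (borel d01) R (fun s => D k * \1_(cell k) s).
  by apply: bmfunM; [exact: bmfun_cst|exact: bmfun_indic].
rewrite dL2_sqr.
apply: (@le_trans _ _ (\int[leb]_s (\sum_(k < N) D k * \1_(cell k) s))).
  apply: Rint_le.
  - by apply/bmfunX/bmfunB; exact: bmfun_G0.
  - by apply: bmfun_sum.
  move=> s; pose x := s%:num.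
  have x0 : 0 <= x by rewrite /x. have x1 : x <= 1 by rewrite /x.
  have [k kN [k1 k2]] : exists2 k, (k < N)%N & (pt k)%:num <= x /\ x <= (pt k.+1)%:num.
    have [/eqP xe1|xn1] := boolP (x == 1).
      exists N.-1; first by rewrite prednK.
      by rewrite prednK// [(pt N)%:num]ptE// divff ?gt_eqF// xe1; split.
    have xlt1 : x < 1 by rewrite lt_neqAle xn1.
    have /andP[t1 t2] := truncn_itv (mulr_ge0 (ltW N0') x0).
    have kN : (Num.truncn (N%:R * x) < N)%N.
      by rewrite -(ltr_nat R); apply: le_lt_trans t1 _; rewrite gtr_pMr.
    exists (Num.truncn (N%:R * x)) => //; rewrite !ptE ?(ltnW kN)//.
    by rewrite ler_pdivrMr// ler_pdivlMr// (mulrC x); split => //; exact: ltW.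
  apply: (@le_trans _ _ (D k)); last first.
    rewrite (bigD1 (Ordinal kN))//= indicE mem_set ?mulr1; last by apply/andP; split.
    by rewrite lerDl sumr_ge0// => i _; rewrite mulr_ge0.
  apply: (@le_trans _ _ `|(g s)%:num - (h s)%:num|).
    rewrite -real_normK ?num_real// expr2 ler_piMr//.
    exact: num01_dist_le1.
  have gk1 : (g (pt k))%:num <= (g s)%:num by exact: (G0_homo g k1).
  have gk2 : (g s)%:num <= (g (pt k.+1))%:num by exact: (G0_homo g k2).
  have hk1 : (h (pt k))%:num <= (h s)%:num by exact: (G0_homo h k1).
  have hk2 : (h s)%:num <= (h (pt k.+1))%:num by exact: (G0_homo h k2).
  have := code_close gh (ltnW kN); have := code_close gh kN.
  rewrite /D !ler_norml => /andP[c1 c2] /andP[c3 c4].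
  move: gk1 gk2 hk1 hk2 c1 c2 c3 c4.
  move: (g _)%:num (g _)%:num (g _)%:num (h _)%:num (h _)%:num (h _)%:num (N%:R^-1).
  by move=> a b c a' b' c' e *; apply/andP; split; lra.
rewrite Rint_sum//.
have -> : \sum_(k < N) \int[leb]_s (D k * \1_(cell k) s) = \sum_(k < N) D k * N%:R^-1.
  apply: eq_bigr => k _; rewrite Rint_Z; last exact: bmfun_indic.
  rewrite Rint_indic//; congr (D k * _).
  have k0 : 0 <= (pt k)%:num by []. have k1 : (pt k.+1)%:num <= 1 by [].
  transitivity (fine ((pt k.+1)%:num - (pt k)%:num)%:E).
    by rewrite -(leb01_cc k0 (ptS k) k1).
  rewrite /= [(pt k.+1)%:num]ptE// [(pt k)%:num]ptE ?(ltnW (ltn_ord k))//.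
  by rewrite -mulrBl -natr1 addrAC subrr add0r mul1r.
rewrite -mulr_suml ler_pM2r ?invr_gt0// /D big_split/=.
rewrite sumr_const card_ord -[X in _ + X]mulr_natr mulVf ?gt_eqF//.
rewrite -(big_mkord xpredT (fun k => (g (pt k.+1))%:num - (g (pt k))%:num)).
rewrite telescope_sumr//.
have g0 : 0 <= (g (pt 0))%:num by []. have g1 : (g (pt N))%:num <= 1 by [].
by rewrite -[leRHS]/(1 + 1) lerD2r; lra.
Qed.

End fixed_mesh.

Lemma G0_net (e : R) : 0 < e ->
  exists s : seq (G0 R), forall g, exists2 h, h \in s & dL2 h g < e.
Proof.
move=> e0; have [n ne] : exists n : nat, n.+1%:R^-1 < e ^+ 2 / 2.
  by apply: inv_nat_lt; rewrite divr_gt0// exprn_gt0.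
pose rep c : G0 R := xget point [set g | mesh_code n.+1 g = c].
exists [seq rep c | c <- enum {: {ffun 'I_n.+2 -> 'I_n.+2}}] => g.
exists (rep (mesh_code n.+1 g)).
  by apply/mapP; exists (mesh_code n.+1 g) => //; rewrite mem_enum.
have hrep : mesh_code n.+1 (rep (mesh_code n.+1 g)) = mesh_code n.+1 g.
  by rewrite /rep; case: xgetP => [//|/(_ g)]; case.
rewrite -(ltr_pXn2r (n := 2))// ?nnegrE ?dL2_ge0 ?(ltW e0)//.
apply: le_lt_trans (mesh_code_dL2 _ hrep) _ => //.
by rewrite mulrC -ltr_pdivlMr.
Qed.

End net_G0.

Section wasserstein_space.
Context {R : realType}.
Local Notation I := {i01 R}.
Local Notation d01 := (@dist01 R).
Local Notation W := (wasserstein d01).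
Implicit Types x y z : Prob R d01.

Lemma eq_wasserstein (X : pointedType) (d : X -> X -> R) (mu mu' nu nu' : Prob R d) :
  (forall A, measurable A -> mu A = mu' A) ->
  (forall A, measurable A -> nu A = nu' A) ->
  wasserstein d mu nu = wasserstein d mu' nu'.
Proof.
move=> mm nn; rewrite /wasserstein (_ : coupling mu nu = coupling mu' nu')//.
apply/seteqP; split => pi cpi A mA; have [h1 h2] := cpi A mA.
  by rewrite h1 h2 mm ?nn.
by rewrite h1 h2 -mm -?nn.
Qed.

(** Defined only up to a null set, which is why the values at t < 1 are
    shown later to be determined ([quantile_Psi]). *)
Definition quantile x : G0 R := sval (cid (Psi_surjective x)).

Lemma Psi_quantile x A : measurable A -> Psi (quantile x) A = x A.
Proof. by rewrite /quantile; case: cid => g /= h /h. Qed.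

(** A coupling sees its marginals through Borel sets only, so [x] may be replaced
    by the image measure [Psi (quantile x)]. *)
Lemma wasserstein_dL2 x y : W x y = dL2 (quantile x) (quantile y).
Proof.
rewrite -wasserstein_Psi; apply: eq_wasserstein => A mA; by rewrite Psi_quantile.
Qed.

Lemma dL2_quantile_Psi g : dL2 (quantile (Psi g)) g = 0.
Proof.
rewrite -wasserstein_Psi -(dL2xx g) -wasserstein_Psi.
by apply: eq_wasserstein => // A mA; rewrite [LHS]Psi_quantile.
Qed.

Lemma wasserstein_tb : tb_pseudometric W.
Proof.
split=> [x y|x y|x y z|x y|e e0]; rewrite ?wasserstein_dL2.
- exact: dL2_ge0.
- exact: dL2C.
- exact: dL2_triangle.
- exact: dL2_le1.
- have [s sP] := G0_net e0.
  exists [seq Psi g | g <- s] => x.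
  have [h hs hx] := sP (quantile x); exists (Psi h); first exact: map_f.
  rewrite wasserstein_dL2; apply: le_lt_trans hx.
  apply: le_trans (dL2_triangle _ h _) _.
  by rewrite dL2_quantile_Psi add0r.
Qed.

End wasserstein_space.

(** * Masses of events under the entropic measure *)

Section any_integral.
Context d (T : measurableType d) (R : realType) (mu : {measure set T -> \bar R}).

Lemma ge0_le_integralT (f g : T -> \bar R) :
  (forall x, (0 <= f x)%E) -> (forall x, (f x <= g x)%E) ->
  (\int[mu]_x f x <= \int[mu]_x g x)%E.
Proof.
move=> f0 fg; have g0 x : (0 <= g x)%E by exact: le_trans (fg x).
rewrite !ge0_integralTE//; apply: le_ereal_sup => _ [h hf <-].
by exists h => // x; exact: le_trans (fg x).
Qed.

End any_integral.

Section lebesgue_tuple_boxes.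
Context {R : realType}.
Local Notation mR := (measurableTypeR R).

Lemma lebesgue_tuple1E (A : set mR) : measurable A ->
  lebesgue_tuple 1 [set v : 1.-tuple mR | A (tnth v ord0)] = lebesgue_measure A.
Proof.
move=> mA; rewrite /= /lebesgue_cons /pushforward.
rewrite (_ : _ @^-1` _ = A `*` setT).
  rewrite product_measure1E//; transitivity (lebesgue_measure A * 1)%E.
    by congr (_ * _)%E; exact: diracT.
  by rewrite mule1.
by apply/seteqP; split => z //= -[].
Qed.

Lemma lebesgue_tuple2E (A B : set mR) : measurable A -> measurable B ->
  lebesgue_tuple 2 [set v : 2.-tuple mR | A (tnth v ord0) /\ B (tnth v (lift ord0 ord0))] =
  (lebesgue_measure A * lebesgue_measure B)%E.
Proof.
move=> mA mB; rewrite [LHS]/= /lebesgue_cons /pushforward.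
rewrite (_ : _ @^-1` _ = A `*` [set v : 1.-tuple mR | B (tnth v ord0)]).
  rewrite product_measure1E//.
    by rewrite -(lebesgue_tuple1E mB).
  by rewrite -[X in measurable X]setTI; exact: measurable_tnth.
by apply/seteqP; split => -[z v]; rewrite /= !(tnth_nth 0).
Qed.

End lebesgue_tuple_boxes.

Section entropic_estimates.
Context {R : realType}.
Local Notation I := {i01 R}.
Local Notation mR := (measurableTypeR R).
Variables (beta : R) (Q : Prob R (@dL2 R)).
Hypothesis QE : entropic_on_G0 beta Q.

Definition marginal N (t : N.-tuple I) (g : G0 R) : N.-tuple mR :=
  map_tuple (fun s => (right_cont_repr g s)%:num) t.

Definition gap_density N (tau : seq R) (x : N.-tuple mR) : R :=
  \prod_(i < N.+1) gap x i `^ (beta * gap tau i - 1).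

Lemma gap_density_ge0 N tau (x : N.-tuple mR) : 0 <= gap_density tau x.
Proof. by apply: prodr_ge0 => i _; exact: powR_ge0. Qed.

(** The constant [C] is the quotient of Gamma factors; it is positive because the
    total mass is 1. All later estimates are up to constants. *)
Lemma entropic_bounds N (t : N.-tuple I) :
  let tau := map_tuple (fun s : I => s%:num) t in simplex tau ->
  exists2 C, 0 < C & forall S S' : set (N.-tuple mR),
    measurable S -> measurable S' ->
    measurable (marginal t @^-1` S : set (borel (@dL2 R))) ->
    forall c, 0 <= c ->
    ((forall x, S' x -> [/\ S x, simplex x & c <= gap_density tau x]) ->
      ((C * c)%:E * lebesgue_tuple N S' <= Q (marginal t @^-1` S))%E) /\
    ((forall x, S x -> simplex x -> gap_density tau x <= c) ->
      (Q (marginal t @^-1` S) <= (C * c)%:E * lebesgue_tuple N S)%E).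
Proof.
move=> tau stau.
pose C := Gamma beta / \prod_(i < N.+1) Gamma (beta * gap tau i).
have C0 : 0 < C.
  have ub : exists M, forall x : N.-tuple mR, `|(1 : R)| <= M.
    by exists 1 => x; rewrite normr1.
  have Q1 : (\int[Q]_g (cst 1%:E g) = 1)%E.
    by rewrite integral_cst// mul1e; exact: probability_setT.
  have h := etrans (esym Q1) (QE stau (@measurable_cst _ _ _ _ setT (1 : R)) ub).
  rewrite ltNge.
  apply/negP => C0.
  have : (1 <= 0 :> \bar R)%E.
    rewrite h; apply: mule_le0_ge0; first by rewrite lee_fin.
    by apply: integral_ge0 => x _; rewrite lee_fin mul1r gap_density_ge0.
  by rewrite leNgt lte_fin ltr01.
exists C => // S S' mS mS' mpre c c0.
have QSE : Q (marginal t @^-1` S) =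
    (C%:E * \int[lebesgue_tuple N]_x
       ((fun x => (\1_S x * gap_density tau x)%:E) \_ (simplex (N := N))) x)%E.
  have h : (\int[Q]_g (\1_S (marginal t g))%:E = C%:E *
      \int[lebesgue_tuple N]_(x in simplex (N := N)) (\1_S x * gap_density tau x)%:E)%E.
    apply: QE => //; exists 1 => x.
    by rewrite indicE; case: (_ \in _); rewrite ?normr1 ?normr0.
  rewrite -integral_mkcond -h.
  transitivity (\int[Q]_g (\1_(marginal t @^-1` S) g)%:E)%E => //.
  by rewrite integral_indic// setIT.
have lE E : measurable E ->
    lebesgue_tuple N E = (\int[lebesgue_tuple N]_x (\1_E x)%:E)%E.
  by move=> mE; rewrite integral_indic// setIT.
split => h.
- rewrite QSE (EFinM C c) -(muleA C%:E c%:E) lee_pmul2l// ?lte_fin//.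
  rewrite lE// -ge0_integralZl//; last first.
    by apply/measurable_EFinP; exact: measurable_indic.
  apply: ge0_le_integralT => x; first by rewrite mule_ge0// lee_fin.
  rewrite indicE; case: (boolP (x \in S')) => [/set_mem/h[Sx sx cx]|_].
    by rewrite patchE mem_set// indicE mem_set// mul1r mule1 lee_fin.
  rewrite mule0 patchE; case: ifP => // _.
  by rewrite lee_fin mulr_ge0// gap_density_ge0.
- rewrite QSE (EFinM C c) -(muleA C%:E c%:E) lee_pmul2l// ?lte_fin//.
  rewrite lE// -ge0_integralZl//; last first.
    by apply/measurable_EFinP; exact: measurable_indic.
  apply: ge0_le_integralT => x.
    rewrite patchE; case: ifP => // _.
    by rewrite lee_fin mulr_ge0// gap_density_ge0.
  rewrite patchE; case: ifP => [/set_mem sx|_]; last by rewrite mule_ge0// lee_fin.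
  rewrite indicE; case: (boolP (x \in S)) => [/set_mem Sx|_].
    by rewrite mul1r mule1 lee_fin h.
  by rewrite mul0r mule0.
Qed.

End entropic_estimates.

Section mass_estimates.
Context {R : realType}.
Local Notation I := {i01 R}.
Local Notation mR := (measurableTypeR R).

Lemma norm_ln_powR (y p : R) : 8^-1 <= y -> y <= 1 ->
  `|p * ln y| <= `|p| * ln 8.
Proof.
move=> y8 y1; have y0 : 0 < y by apply: lt_le_trans y8.
have l1 : ln y <= 0 by exact: ln_le0.
have l8 : - ln 8 <= ln y by rewrite -lnV ?posrE// ler_ln ?posrE ?invr_gt0.
by rewrite normrM ler_wpM2l// ler_norml l8 (le_trans l1)// ln_ge0//; lra.
Qed.

Lemma powR_ge8 (y p : R) : 8^-1 <= y -> y <= 1 -> 8 `^ (- `|p|) <= y `^ p.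
Proof.
move=> y8 y1; have y0 : 0 < y by apply: lt_le_trans y8.
have := norm_ln_powR p y8 y1; rewrite ler_norml -mulNr => /andP[h _].
by rewrite /powR !gt_eqF// ler_expR.
Qed.

Lemma powR_le8 (y p : R) : 8^-1 <= y -> y <= 1 -> y `^ p <= 8 `^ `|p|.
Proof.
move=> y8 y1; have y0 : 0 < y by apply: lt_le_trans y8.
have := norm_ln_powR p y8 y1; rewrite ler_norml => /andP[_ h].
by rewrite /powR !gt_eqF// ler_expR.
Qed.

Lemma powR_antimono (x y p : R) : 0 < x -> x <= y -> p <= 0 -> y `^ p <= x `^ p.
Proof.
move=> x0 xy p0; have y0 : 0 < y by exact: lt_le_trans xy.
rewrite /powR !gt_eqF// ler_expR ler_wnM2l// ler_ln//.
Qed.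

Lemma measurable_eval_lt (t : I) (c : R) : t%:num < 1 ->
  measurable ([set g : G0 R | (g t)%:num < c] : set (borel (@dL2 R))).
Proof.
move=> t1; apply: sub_sigma_algebra => g /= gc.
have [e e0 he] := dL2_lt_open t1 gc.
by exists e => // h /= gh; exact: he.
Qed.

Lemma measurable_eval_ge (t : I) (c : R) : t%:num < 1 ->
  measurable ([set g : G0 R | c <= (g t)%:num] : set (borel (@dL2 R))).
Proof.
move=> t1; rewrite (_ : [set _ | _] = ~` [set g : G0 R | (g t)%:num < c]).
  by apply: measurableC; exact: measurable_eval_lt.
by apply/seteqP; split => g /=; rewrite leNgt => /negP.
Qed.

Variables (beta : R) (Q : Prob R (@dL2 R)).
Hypotheses (beta0 : 0 < beta) (QE : entropic_on_G0 beta Q).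

Lemma gap_density1 (a t : R) :
  gap_density beta [:: t] ([tuple a] : 1.-tuple mR) =
  a `^ (beta * t - 1) * (1 - a) `^ (beta * (1 - t) - 1).
Proof.
by rewrite /gap_density !big_ord_recl big_ord0 /gap /knots /= !subr0 mulr1.
Qed.

Lemma gap_density2 (a b s t : R) :
  gap_density beta [:: s; t] ([tuple a; b] : 2.-tuple mR) =
  a `^ (beta * s - 1) * (b - a) `^ (beta * (t - s) - 1) *
  (1 - b) `^ (beta * (1 - t) - 1).
Proof.
by rewrite /gap_density !big_ord_recl big_ord0 /gap /knots /= !subr0 mulr1 mulrA.
Qed.

Lemma tuple1E (v : 1.-tuple mR) : v = [tuple tnth v ord0].
Proof. by apply: eq_from_tnth => i; rewrite ord1 !(tnth_nth 0). Qed.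

Lemma tuple2E (v : 2.-tuple mR) : v = [tuple tnth v ord0; tnth v (lift ord0 ord0)].
Proof.
case/tupleP: v => a v; case/tupleP: v => b v; rewrite [v]tuple0.
by apply: val_inj; rewrite /= !(tnth_nth 0).
Qed.

Lemma lebesgue_co (a b : R) : a <= b ->
  lebesgue_measure (`[a, b[%classic : set mR) = (b - a)%:E.
Proof.
move=> ab; rewrite lebesgue_measure_itv/= lte_fin.
by case: ltgtP ab => //= ->; rewrite subrr.
Qed.

Lemma lebesgue_oo (a b : R) : a <= b ->
  lebesgue_measure (`]a, b[%classic : set mR) = (b - a)%:E.
Proof.
move=> ab; rewrite lebesgue_measure_itv/= lte_fin.
by case: ltgtP ab => //= ->; rewrite subrr.
Qed.

Lemma measurable_tnth_itv N (i : 'I_N) (J : interval R) :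
  measurable [set v : N.-tuple mR | [set` J] (tnth v i)].
Proof.
rewrite -[X in measurable X]setTI.
by apply: measurable_tnth => //; exact: measurable_itv.
Qed.

(** Near 0 the density of g(t) is at least a constant times
    e ^ (beta t - 1) on ]0, e[. *)
Lemma mass_low (t : I) : 0 < t%:num -> t%:num < 1 -> beta * t%:num <= 1 ->
  exists2 c, 0 < c & forall e, 0 < e -> e <= 2^-1 ->
    ((c * e `^ (beta * t%:num))%:E <= Q [set g : G0 R | ((g t)%:num < e)%R])%E.
Proof.
move=> t0 t1 bt.
have st : simplex (map_tuple (fun s : I => s%:num) [tuple t]).
  by rewrite /simplex /knots/= t0 t1.
have [C C0 hC] := entropic_bounds QE st.
pose k : R := 8 `^ (- `|beta * (1 - t%:num) - 1|).
have k0 : 0 < k by exact: powR_gt0.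
exists (C * k); first exact: mulr_gt0.
move=> e e0 e2.
pose S : set (1.-tuple mR) := [set v | [set` `]-oo, e[] (tnth v ord0)].
pose S' : set (1.-tuple mR) := [set v | [set` `]0, e[] (tnth v ord0)].
have mS : measurable S by exact: measurable_tnth_itv.
have mS' : measurable S' by exact: measurable_tnth_itv.
have preE : marginal [tuple t] @^-1` S = [set g : G0 R | (g t)%:num < e].
  by apply/seteqP; split => g; rewrite /S/= in_itv/= !(tnth_nth 0).
have mpre : measurable (marginal [tuple t] @^-1` S : set (borel (@dL2 R))).
  by rewrite preE; exact: measurable_eval_lt.
have c0 : 0 <= e `^ (beta * t%:num - 1) * k by rewrite mulr_ge0 ?powR_ge0.
have [low _] := hC S S' mS mS' mpre _ c0.
move: low; rewrite preE => low.
have -> : (C * k * e `^ (beta * t%:num))%:E =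
    ((C * (e `^ (beta * t%:num - 1) * k))%:E * lebesgue_tuple 1 S')%E.
  rewrite (lebesgue_tuple1E (measurable_itv _)) lebesgue_oo ?(ltW e0)// subr0.
  rewrite -EFinM -(mulr_powRB1 (ltW e0)) ?mulr_gt0//; congr EFin; ring.
apply: low => v; rewrite (tuple1E v); set a := tnth v ord0.
rewrite /S' /S /= !(tnth_nth 0)/= !in_itv/= => /andP[a0 ae]; split => //.
  by rewrite /simplex /knots/= a0/= andbT; lra.
rewrite gap_density1; apply: ler_pM; rewrite ?powR_ge0 ?(ltW k0)//.
  by apply: powR_antimono => //; [exact: ltW|lra].
by apply: powR_ge8; lra.
Qed.

(** Away from 0 and 1 the density of g(t) is bounded. *)
Lemma mass_mid (t : I) : 0 < t%:num -> t%:num < 1 ->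
  exists2 c, 0 < c & forall e, 0 < e -> e <= 16^-1 ->
    (Q [set g : G0 R | (4^-1 - 2 * e <= (g t)%:num < 4^-1 + 2 * e)%R] <= (c * e)%:E)%E.
Proof.
move=> t0 t1.
have st : simplex (map_tuple (fun s : I => s%:num) [tuple t]).
  by rewrite /simplex /knots/= t0 t1.
have [C C0 hC] := entropic_bounds QE st.
pose k : R := 8 `^ `|beta * t%:num - 1| * 8 `^ `|beta * (1 - t%:num) - 1|.
have k0 : 0 < k by rewrite mulr_gt0// powR_gt0.
exists (C * k * 4); first by rewrite !mulr_gt0.
move=> e e0 e16.
pose J : interval R := `[4^-1 - 2 * e, 4^-1 + 2 * e[.
pose S : set (1.-tuple mR) := [set v | [set` J] (tnth v ord0)].
have mS : measurable S by exact: measurable_tnth_itv.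
have preE : marginal [tuple t] @^-1` S =
    [set g : G0 R | 4^-1 - 2 * e <= (g t)%:num < 4^-1 + 2 * e].
  by apply/seteqP; split => g; rewrite /S/= in_itv/= !(tnth_nth 0).
have mpre : measurable (marginal [tuple t] @^-1` S : set (borel (@dL2 R))).
  rewrite preE (_ : mkset _ = [set g : G0 R | 4^-1 - 2 * e <= (g t)%:num] `&`
      [set g : G0 R | (g t)%:num < 4^-1 + 2 * e]).
    by apply: measurableI; [exact: measurable_eval_ge|exact: measurable_eval_lt].
  by apply/seteqP; split => g /= => [/andP[]//|[-> ->]].
have [_ up] := hC S S mS mS mpre _ (ltW k0).
move: up; rewrite preE => up.
have -> : (C * k * 4 * e)%:E = ((C * k)%:E * lebesgue_tuple 1 S)%E.
  rewrite (lebesgue_tuple1E (measurable_itv _)) lebesgue_co; last by lra.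
  by rewrite -EFinM; congr EFin; ring.
apply: up => v; rewrite (tuple1E v); set a := tnth v ord0.
rewrite /S /J /= !(tnth_nth 0)/= !in_itv/= => /andP[a1 a2] _.
rewrite gap_density1; apply: ler_pM; rewrite ?powR_ge0//.
  by apply: powR_le8; lra.
by apply: powR_le8; lra.
Qed.

(** The rectangle ]1/2 - e, 1/2[ x ]1/2, 1/2 + e[ has area e ^ 2, and on it the
    gap is at most 2 e, so that its power in the density, whose exponent is not
    positive, is at least of order e ^ (beta (t' - t) - 1). *)
Lemma mass_flat (t t' : I) : 0 < t%:num -> t%:num < t'%:num -> t'%:num < 1 ->
  beta * (t'%:num - t%:num) <= 1 ->
  exists2 c, 0 < c & forall e, 0 < e -> e <= 4^-1 ->
    ((c * e `^ (1 + beta * (t'%:num - t%:num)))%:E <=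
     Q [set g : G0 R | (2^-1 - e <= (g t)%:num)%R /\ ((g t')%:num < 2^-1 + e)%R])%E.
Proof.
move=> t0 tt' t'1 bt.
have st : simplex (map_tuple (fun s : I => s%:num) [tuple t; t']).
  by rewrite /simplex /knots/= t0 tt' t'1.
have [C C0 hC] := entropic_bounds QE st.
pose b := beta * (t'%:num - t%:num).
have b0 : 0 < b by rewrite mulr_gt0// subr_gt0.
pose k1 : R := 8 `^ (- `|beta * t%:num - 1|).
pose k2 : R := 8 `^ (- `|beta * (1 - t'%:num) - 1|).
have k10 : 0 < k1 by exact: powR_gt0.
have k20 : 0 < k2 by exact: powR_gt0.
have k30 : 0 < 2 `^ (b - 1) :> R by exact: powR_gt0.
exists (C * (k1 * 2 `^ (b - 1) * k2)); first by rewrite !mulr_gt0.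
move=> e e0 e4.
pose S : set (2.-tuple mR) :=
  [set v | [set` `[2^-1 - e, +oo[] (tnth v ord0)] `&`
  [set v | [set` `]-oo, 2^-1 + e[] (tnth v (lift ord0 ord0))].
pose S' : set (2.-tuple mR) :=
  [set v | [set` `]2^-1 - e, 2^-1[] (tnth v ord0)] `&`
  [set v | [set` `]2^-1, 2^-1 + e[] (tnth v (lift ord0 ord0))].
have mS : measurable S by apply: measurableI; exact: measurable_tnth_itv.
have mS' : measurable S' by apply: measurableI; exact: measurable_tnth_itv.
have preE : marginal [tuple t; t'] @^-1` S =
    [set g : G0 R | 2^-1 - e <= (g t)%:num /\ (g t')%:num < 2^-1 + e].
  by apply/seteqP; split => g; rewrite /S/= !in_itv/= !(tnth_nth 0)/= andbT.
have mpre : measurable (marginal [tuple t; t'] @^-1` S : set (borel (@dL2 R))).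
  rewrite preE; apply: (@measurableI _ (borel (@dL2 R))).
    by apply: measurable_eval_ge; lra.
  exact: measurable_eval_lt.
have c0 : 0 <= k1 * (2 * e) `^ (b - 1) * k2 by rewrite !mulr_ge0 ?powR_ge0.
have [low _] := hC S S' mS mS' mpre _ c0.
move: low; rewrite preE => low.
have -> : (C * (k1 * 2 `^ (b - 1) * k2) * e `^ (1 + b))%:E =
    ((C * (k1 * (2 * e) `^ (b - 1) * k2))%:E * lebesgue_tuple 2 S')%E.
  rewrite (lebesgue_tuple2E (measurable_itv _) (measurable_itv _)).
  rewrite !lebesgue_oo; [|lra..].
  rewrite -!EFinM powRM ?(ltW e0)// (@powRD _ e 1 b); last by rewrite (gt_eqF e0) implybT.
  rewrite powRr1 ?(ltW e0)// -(mulr_powRB1 (ltW e0) b0); congr EFin; ring.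
apply: low => v; rewrite (tuple2E v); set x := tnth v ord0; set y := tnth v _.
rewrite /S' /S /= !(tnth_nth 0)/= !in_itv/= => -[/andP[x1 x2] /andP[y1 y2]]; split.
- by rewrite andbT; split; lra.
- by rewrite /simplex /knots/= andbT; do !(apply/andP; split); lra.
rewrite gap_density2; apply: ler_pM; rewrite ?mulr_ge0 ?powR_ge0 ?(ltW k20)//.
  apply: ler_pM; rewrite ?powR_ge0//.
    by apply: powR_ge8; lra.
  by apply: powR_antimono; [lra|lra|rewrite subr_le0].
by apply: powR_ge8; lra.
Qed.

End mass_estimates.

(** * Failure of the Ricci bound *)

Section evaluation_on_P0.
Context {R : realType}.
Local Notation I := {i01 R}.
Local Notation d01 := (@dist01 R).
Local Notation W := (wasserstein d01).

(** Functions at L2 distance 0 have the same values on [0, 1[, by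
    [dL2_lt_open]. *)
Lemma quantile_Psi (g : G0 R) (t : I) : t%:num < 1 ->
  (quantile (Psi g) t)%:num = (g t)%:num.
Proof.
move=> t1.
have le (h k : G0 R) : dL2 h k = 0 -> (k t)%:num <= (h t)%:num.
  move=> hk; rewrite leNgt; apply/negP => /(dL2_lt_open t1)[e e0 /(_ k)].
  by rewrite hk ltxx => /(_ e0).
have hk := dL2_quantile_Psi g.
by apply/eqP; rewrite eq_le !le// dL2C.
Qed.

Lemma measurable_quantile_lt (t : I) (c : R) : t%:num < 1 ->
  measurable ([set x | (quantile x t)%:num < c] : set (borel W)).
Proof.
move=> t1; apply: sub_sigma_algebra => x /= xc.
have [e e0 he] := dL2_lt_open t1 xc.
by exists e => // y /=; rewrite wasserstein_dL2; exact: he.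
Qed.

Lemma measurable_quantile_ge (t : I) (c : R) : t%:num < 1 ->
  measurable ([set x | c <= (quantile x t)%:num] : set (borel W)).
Proof.
move=> t1; rewrite (_ : [set _ | _] = ~` [set x | (quantile x t)%:num < c]).
  by apply: measurableC; exact: measurable_quantile_lt.
by apply/seteqP; split => g /=; rewrite leNgt => /negP.
Qed.

Definition low_event (t : I) (e : R) : set (borel W) :=
  [set x | (quantile x t)%:num < e].

Definition flat_event (s t : I) (e : R) : set (borel W) :=
  [set x | 2^-1 - e <= (quantile x s)%:num /\ (quantile x t)%:num < 2^-1 + e].

Definition mid_event (t : I) (e : R) : set (borel W) :=
  [set x | 4^-1 - 2 * e <= (quantile x t)%:num < 4^-1 + 2 * e].

(** Let g, h and k be the quantile functions of [x], [z] and [y]. The squared L2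
    norm of 2 k - g - h is the defect in the parallelogram identity. If k(t) is
    too large for the middle event, then 2 k - g - h >= e on [t, u[; if it is
    too small, then 2 k - g - h <= - e on [s, t[. *)
Lemma mid_event_midpoint (s t u : I) (tau e : R) x y z :
  0 < e -> 0 <= tau -> t%:num = s%:num + tau -> u%:num = t%:num + tau ->
  low_event u e x -> flat_event s u e z -> ~ mid_event t e y ->
  W x z ^+ 2 + e ^+ 2 * tau <= 2 * W x y ^+ 2 + 2 * W y z ^+ 2.
Proof.
move=> e0 tau0 ts ut Ax [Az1 Az2] By; rewrite !wasserstein_dL2.
rewrite -(dL2_parallelogram (quantile x) (quantile z) (quantile y)) lerD2l.
rewrite /low_event /mid_event/= in Ax By.
move: (quantile x) (quantile z) (quantile y) Ax Az1 Az2 By => g h k g1 h1 h2.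
move=> /negP; rewrite negb_and -ltNge -leNgt => k12.
have bf : @bmfun _ (borel d01) R
    (fun s => (2 * (k s)%:num - (g s)%:num - (h s)%:num) ^+ 2).
  apply/bmfunX/bmfunB; last exact: bmfun_G0.
  apply: bmfunB; last exact: bmfun_G0.
  by apply: bmfunM; [exact: bmfun_cst|exact: bmfun_G0].
have s0 : 0 <= s%:num by []. have u1 : u%:num <= 1 by [].
have sq0 v : 0 <= (2 * (k v)%:num - (g v)%:num - (h v)%:num) ^+ 2 by exact: sqr_ge0.
have sq (w : R) : e <= `|w| -> e ^+ 2 <= w ^+ 2.
  by move=> ew; rewrite -(real_normK (num_real w)) ler_pXn2r ?nnegrE ?(ltW e0).
have [k2|k1] := orP k12; last first.
  have -> : tau = u%:num - t%:num by rewrite ut; ring.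
  apply: Rint_ge_co => //; [by rewrite ut lerDl|].
  move=> v /andP[tv vu]; apply: sq.
  have gv : (g v)%:num <= (g u)%:num by exact: (G0_homo g (ltW vu)).
  have hv : (h v)%:num <= (h u)%:num by exact: (G0_homo h (ltW vu)).
  have kv : (k t)%:num <= (k v)%:num by exact: (G0_homo k tv).
  by apply: le_trans (ler_norm _); lra.
have -> : tau = t%:num - s%:num by rewrite ts; ring.
apply: Rint_ge_co => //; [by rewrite ts lerDl|].
move=> v /andP[sv vt]; apply: sq.
have g0 : 0 <= (g v)%:num by [].
have hv : (h s)%:num <= (h v)%:num by exact: (G0_homo h sv).
have kv : (k v)%:num <= (k t)%:num by exact: (G0_homo k (ltW vt)).
by rewrite -normrN; apply: le_trans (ler_norm _); lra.
Qed.

End evaluation_on_P0.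

Lemma growth_contradiction (R : realType) (M l b : R) :
  6 * `|M| + 1 <= l -> b <= 8^-1 -> l * (1 - 5 * b) / 2 <= M -> False.
Proof.
move=> lM b8 lb; have := ler_norm M; have := normr_ge0 M.
have l0 : 0 <= l by apply: le_trans lM; rewrite addr_ge0// mulr_ge0.
have : l * (3 / 8) <= l * (1 - 5 * b) by rewrite ler_wpM2l//; lra.
lra.
Qed.

Theorem corollary1p2 (R : realType) :
  ~ exists (K beta : R) (Q : Prob R (@dL2 R)),
      [/\ 0 < beta, entropic_on_G0 beta Q
        & generalized_Ric_ge (wasserstein (@dist01 R)) (Psi_pushforward Q) K].
Proof.
move=> [K [beta [Q [beta0 QE ric]]]].
(* This makes beta tau < 1/8: with s = tau, t = 2 tau and u = 3 tau the
   exponents satisfy beta u + beta (u - s) = 5 beta tau < 1. *)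
pose tau : R := (8 * (1 + beta))^-1.
have b1 : 0 < 1 + beta by lra.
have tau0 : 0 < tau by rewrite invr_gt0 mulr_gt0.
have tauE : tau + beta * tau = 8^-1.
  by rewrite /tau; field; rewrite gt_eqF.
have btau0 : 0 < beta * tau by rewrite mulr_gt0.
pose s : {i01 R} := clamp01 tau.
pose t : {i01 R} := clamp01 (2 * tau).
pose u : {i01 R} := clamp01 (3 * tau).
have sE : s%:num = tau by rewrite /s clamp01_val//; apply/andP; split; lra.
have tE : t%:num = 2 * tau by rewrite /t clamp01_val//; apply/andP; split; lra.
have uE : u%:num = 3 * tau by rewrite /u clamp01_val//; apply/andP; split; lra.
have [c0 c00 low] : exists2 c, 0 < c & forall e, 0 < e -> e <= 2^-1 ->
    ((c * e `^ (beta * u%:num))%:E <= Q [set g : G0 R | ((g u)%:num < e)%R])%E.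
  by apply: (mass_low beta0 QE); rewrite uE; lra.
have [c1 c10 flat] : exists2 c, 0 < c & forall e, 0 < e -> e <= 4^-1 ->
    ((c * e `^ (1 + beta * (u%:num - s%:num)))%:E <=
     Q [set g : G0 R | (2^-1 - e <= (g s)%:num)%R /\ ((g u)%:num < 2^-1 + e)%R])%E.
  by apply: (mass_flat beta0 QE); rewrite ?uE ?sE; lra.
have [c2 c20 mid] : exists2 c, 0 < c & forall e, 0 < e -> e <= 16^-1 ->
    (Q [set g : G0 R | (4^-1 - 2 * e <= (g t)%:num < 4^-1 + 2 * e)%R] <= (c * e)%:E)%E.
  by apply: (mass_mid QE); rewrite tE; lra.
(* [M] collects all the constants of the final inequality, which bounds
   - ln e times a positive constant by [M]; [L] is a lower bound of - ln e
   that [M] cannot match. *)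
pose M := c2 - ln c0 / 2 - ln c1 / 2 + `|K| / 8.
pose L := 6 * `|M| + 1.
pose e : R := 16^-1 * expR (- L).
have L0 : 0 < L by rewrite ltr_wpDl// mulr_ge0.
have e0 : 0 < e by rewrite mulr_gt0 ?expR_gt0.
have e16 : e <= 16^-1.
  by rewrite ler_piMr// -expR0 ler_expR oppr_le0 ltW.
have lne : L <= - ln e.
  rewrite lnM ?posrE ?expR_gt0// expRK lnV ?posrE// opprD !opprK lerDr.
  by rewrite ln_ge0//; lra.
have s1 : s%:num < 1 by rewrite sE; lra.
have t1 : t%:num < 1 by rewrite tE; lra.
have u1 : u%:num < 1 by rewrite uE; lra.
have mA0 : measurable (low_event u e) by exact: measurable_quantile_lt.
have mA1 : measurable (flat_event s u e).
  apply: (@measurableI _ (borel (wasserstein (@dist01 R)))).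
    exact: measurable_quantile_ge.
  exact: measurable_quantile_lt.
have mB : measurable (mid_event t e).
  rewrite (_ : mid_event t e = [set x | 4^-1 - 2 * e <= (quantile x t)%:num] `&`
      [set x | (quantile x t)%:num < 4^-1 + 2 * e]).
    apply: (@measurableI _ (borel (wasserstein (@dist01 R)))).
      exact: measurable_quantile_ge.
    exact: measurable_quantile_lt.
  by apply/seteqP; split => x; rewrite /mid_event/= => /andP.
set m := Psi_pushforward Q.
have A0E : m (low_event u e) = Q [set g : G0 R | ((g u)%:num < e)%R].
  congr (Q _); apply/seteqP; split => g;
    by rewrite /low_event/= /Psi_map quantile_Psi.
have A1E : m (flat_event s u e) =
    Q [set g : G0 R | (2^-1 - e <= (g s)%:num)%R /\ ((g u)%:num < 2^-1 + e)%R].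
  congr (Q _); apply/seteqP; split => g;
    by rewrite /flat_event/= /Psi_map !quantile_Psi.
have BE : m (mid_event t e) =
    Q [set g : G0 R | (4^-1 - 2 * e <= (g t)%:num < 4^-1 + 2 * e)%R].
  congr (Q _); apply/seteqP; split => g;
    by rewrite /mid_event/= /Psi_map !quantile_Psi.
have A0ge : c0 * e `^ (beta * u%:num) <= fine (m (low_event u e)).
  by rewrite -lee_fin fineK ?fin_num_measure// A0E; apply: low => //; lra.
have A1ge : c1 * e `^ (1 + beta * (u%:num - s%:num)) <= fine (m (flat_event s u e)).
  by rewrite -lee_fin fineK ?fin_num_measure// A1E; apply: flat => //; lra.
have Ble : fine (m (mid_event t e)) <= c2 * e.
  by rewrite -lee_fin fineK ?fin_num_measure// BE; apply: mid.
have a00 : 0 < c0 * e `^ (beta * u%:num) by rewrite mulr_gt0// powR_gt0.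
have a10 : 0 < c1 * e `^ (1 + beta * (u%:num - s%:num)) by rewrite mulr_gt0// powR_gt0.
have far x y z := @mid_event_midpoint R s t u tau e x y z e0 (ltW tau0).
have := @Ric_midpoint_inequality R _ _ wasserstein_tb m K (e ^+ 2 * tau) e _ _ _ ric
  mA0 mA1 mB (lt_le_trans a00 A0ge) (lt_le_trans a10 A1ge) _ e0 _ _.
have kap : 0 < e ^+ 2 * tau by rewrite mulr_gt0// exprn_gt0.
have e1 : e <= 1 by lra.
have ts : t%:num = s%:num + tau by rewrite tE sE; ring.
have ut : u%:num = t%:num + tau by rewrite tE uE; ring.
move=> /(_ kap e1 (fun x y z => far x y z ts ut)).
have B2 : fine (m (mid_event t e)) / e <= c2 by rewrite ler_pdivrMr.
have l0 : ln c0 + beta * u%:num * ln e <= ln (fine (m (low_event u e))).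
  rewrite -ln_powR -lnM ?posrE ?powR_gt0// ler_ln ?posrE//.
  exact: lt_le_trans A0ge.
have l1 : ln c1 + (1 + beta * (u%:num - s%:num)) * ln e <=
    ln (fine (m (flat_event s u e))).
  rewrite -ln_powR -lnM ?posrE ?powR_gt0// ler_ln ?posrE//.
  exact: lt_le_trans A1ge.
move=> main.
have aE : beta * u%:num = 3 * (beta * tau) by rewrite uE; ring.
have bE : beta * (u%:num - s%:num) = 2 * (beta * tau) by rewrite uE sE; ring.
rewrite aE in l0; rewrite bE in l1.
have key : - ln e * (1 - 5 * (beta * tau)) / 2 <= M.
  rewrite /M; move: main l0 l1 B2.
  move: (ln (fine _)) (ln (fine _)) (_ / e) (ln c0) (ln c1) (ln e) (beta * tau).
  move=> x0 x1 x2 y0 y1 y2 bt *; lra.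
apply: (growth_contradiction lne _ key); lra.
Qed.
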